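(* Let $\{\boldsymbol{\xi}_t\}_{0\le t\le1}$ be an $n$-dimensional GLP and $R_t=\mathbf{1}\cdot\boldsymbol{\xi}_t$. If $\mathbb{E}(|\mathbf{1}\cdot\boldsymbol{\xi}_t|)<\infty$ for $t\in[0,1]$, then $\{\boldsymbol{\xi}_t\}_{0\le t\le1}$ and $\{R_t\}_{0\le t\le1}$ are harnesses.
   Context: For $\mathbf{x}\in\mathbb{R}^n$ write $\mathbf{1}\cdot\mathbf{x}=\sum_i x_i$. All processes are càdlàg on a probability space $(\Omega,\mathcal{F},\mathbb{P})$. Harness. A measurable process $\{H_t\}$ (real- or vector-valued, indexed by $[0,1]$ here) is a harness if $\mathbb{E}(|H_t|)<\infty$ for all $t$ and, for all $0\le a<b<c<d$ in the index set, $$\mathbb{E}\Big(\frac{H_c-H_b}{c-b}\,\Big|\,\mathcal{H}_{a,d}\Big)=\frac{H_d-H_a}{d-a},\qquad \mathcal{H}_{a,d}=\sigma(\{H_t\}_{t\le a},\{H_t\}_{t\ge d}).$$ Lévy random bridge (LRB). Let $T>0$, let $\nu$ be a probability law on $\mathbb{R}$, and let $\{X_t\}$ be a real-valued Lévy process such that $X_t$ has a density $f_t$ for all $t\in(0,T]$, with $f_t(x)=\int_{\mathbb{R}}f_{t-s}(x-y)f_s(y)\,dy$ for $0<s<t\le T$, $x\in\mathbb{R}$, and $0<f_T(z)<\infty$ for $\nu$-a.e. $z$. A process $\{L_t\}_{0\le t\le T}$ is an LRB with generating law $\nu$ if $L_T$ has law $\nu$ and, for all $k\ge 1$, $0<t_1<\cdots<t_k<T$,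 $(x_1,\dots,x_k)\in\mathbb{R}^k$ and $\nu$-a.e. $z$, $\mathbb{P}(L_{t_1}\le x_1,\dots,L_{t_k}\le x_k\mid L_T=z)=\mathbb{P}(X_{t_1}\le x_1,\dots,X_{t_k}\le x_k\mid X_T=z)$. Equivalently (with $t_0=0$, $x_0=0$), $$\mathbb{P}(L_{t_1}\in dx_1,\dots,L_{t_k}\in dx_k,L_T\in dz)=\prod_{i=1}^k\big(f_{t_i-t_{i-1}}(x_i-x_{i-1})\,dx_i\big)\frac{f_{T-t_k}(z-x_k)}{f_T(z)}\,\nu(dz).$$ Generalised Liouville process (GLP). Let $n\ge2$, $m_1,\dots,m_n>0$, $u_0=0$, $u_i=u_{i-1}+m_i$. A process $\{\boldsymbol{\xi}_t\}_{0\le t\le1}$ is an $n$-dimensional GLP with generating law $\nu$ and activity parameter $\mathbf{m}=(m_1,\dots,m_n)^\top$ if it is equal in law to the process with coordinates $L_{tm_i+u_{i-1}}-L_{u_{i-1}}$, $i=1,\dots,n$, $0\le t\le1$, for some LRB $\{L_t\}_{0\le t\le u_n}$ with generating law $\nu$. It is assumed throughout that $\nu$ has no continuous singular part. *)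

(* Defs.v *)
From HB Require Import structures.
From mathcomp Require Import all_boot all_order all_algebra.
From mathcomp Require Import all_classical all_reals all_analysis.
From mathcomp Require Import measurable_realfun.

Set Implicit Arguments.
Unset Strict Implicit.
Unset Printing Implicit Defensive.

Import Order.TTheory GRing.Theory Num.Theory.
Import numFieldNormedType.Exports.

Local Open Scope classical_set_scope.
Local Open Scope ring_scope.
Local Open Scope ereal_scope.

(* Processes are functions X : R -> Omega -> E (time first, E = R or
   E = 'rV[R]_n).  They are total in time, but each notion below takes the
   index set I : set R into account and never looks at times outside I. *)

(* sigma({H_t}_(t in J)), for an R^n-valued H; it is generated by the
   coordinates of the H_t *)
Definition sigma_process (R : realType) (S : Type) (n : nat) (J : set R)
    (H : R -> S -> 'rV[R]_n) : set (set S) :=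
  <<s [set A | exists t i (B : set (measurableTypeR R)),
         [/\ J t, measurable B & A = [set w | B (H t w ord0 i)]]] >>.

(* Equality in law of two R^n-valued processes indexed by I, possibly on
   different probability spaces: the laws on path space, equipped with the
   cylinder sigma-algebra, coincide. *)
Definition eq_in_law (R : realType) (d d' : measure_display)
    (Omega : measurableType d) (Omega' : measurableType d')
    (P : probability Omega R) (P' : probability Omega' R) (n : nat) (I : set R)
    (X : R -> Omega -> 'rV[R]_n) (Y : R -> Omega' -> 'rV[R]_n) : Prop :=
  forall A : set (R -> 'rV[R]_n), sigma_process I (fun t x => x t) A ->
    P [set w | A (X ^~ w)] = P' [set w | A (Y ^~ w)].

(* I is meant to be an interval *)
Definition cadlag (R : realType) (I : set R) (g : R -> R) : Prop :=
  forall t : R, I t ->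
    ((exists2 s, I s & (t < s)%R) -> g x @[x --> t^'+] --> g t) /\
    ((exists2 s, I s & (s < t)%R) -> cvg (g x @[x --> t^'-])).

Definition cadlag_process (R : realType) (d : measure_display)
    (Omega : measurableType d) (I : set R) (X : R -> Omega -> R) : Prop :=
  (forall t, I t -> measurable_fun [set: Omega] (X t)) /\
  (forall w, cadlag I (X ^~ w)).

(* Y is a version of E(X | G); G is meant to be a sub-sigma-algebra and X
   to be integrable *)
Definition is_cond_exp (R : realType) (d : measure_display)
    (Omega : measurableType d) (P : probability Omega R)
    (G : set (set Omega)) (X Y : Omega -> R) : Prop :=
  [/\ P.-integrable [set: Omega] (EFin \o Y),
      (forall B : set (measurableTypeR R), measurable B -> G (Y @^-1` B)) &
      (forall A, G A ->
         \int[P]_(w in A) (X w)%:E = \int[P]_(w in A) (Y w)%:E)].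

Definition euclid_norm (R : realType) (n : nat) (x : 'rV[R]_n) : R :=
  Num.sqrt (\sum_(i < n) x ord0 i ^+ 2)%R.

(* Harness indexed by [0, 1]; the conditional expectation of a vector is taken
   coordinate by coordinate. *)
Definition harness (R : realType) (d : measure_display)
    (Omega : measurableType d) (P : probability Omega R) (n : nat)
    (H : R -> Omega -> 'rV[R]_n) : Prop :=
  [/\ (forall i, measurable_fun
         ((`[0%R, 1%R] : set (measurableTypeR R)) `*` [set: Omega])
         (fun p : measurableTypeR R * Omega => H p.1 p.2 ord0 i)),
      (forall t : R, (0 <= t <= 1)%R -> 'E_P[fun w => euclid_norm (H t w)] < +oo) &
      (forall a b c e : R,
         (0 <= a)%R -> (a < b)%R -> (b < c)%R -> (c < e)%R -> (e <= 1)%R ->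
         forall i,
         is_cond_exp P
           (sigma_process
              (`[0%R, 1%R] `&` [set t | (t <= a)%R \/ (e <= t)%R]) H)
           (fun w => (H c w ord0 i - H b w ord0 i) / (c - b))%R
           (fun w => (H e w ord0 i - H a w ord0 i) / (e - a))%R)].

Definition real_harness (R : realType) (d : measure_display)
    (Omega : measurableType d) (P : probability Omega R)
    (H : R -> Omega -> R) : Prop :=
  harness P (fun t w => \row_(i < 1) H t w).

Definition levy_process (R : realType) (d : measure_display)
    (Omega : measurableType d) (P : probability Omega R)
    (X : R -> Omega -> R) : Prop :=
  [/\ cadlag_process `[0%R, +oo[ X,
      {ae P, forall w, X 0%R w = 0%R},
      (forall (k : nat) (t : nat -> R) (B : nat -> set (measurableTypeR R)),
         (0 <= t 0%N)%R -> (forall i, (i < k)%N -> (t i < t i.+1)%R) ->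
         (forall i, measurable (B i)) ->
         P [set w | forall i, (i < k)%N -> B i (X (t i.+1) w - X (t i) w)%R] =
         \prod_(i < k) P [set w | B i (X (t i.+1) w - X (t i) w)%R]) &
      (forall (s t : R) (B : set (measurableTypeR R)),
         (0 <= s)%R -> (0 <= t)%R -> measurable B ->
         P [set w | B (X (s + t)%R w - X s w)%R] = P [set w | B (X t w)])].

(* f t is a density of X t for t in (0, T], and the f t satisfy the
   Chapman-Kolmogorov identity everywhere.  Densities may take the value +oo
   (as happens at the origin for some Levy processes at small times). *)
Definition levy_densities (R : realType) (d : measure_display)
    (Omega : measurableType d) (P : probability Omega R)
    (X : R -> Omega -> R) (T : R) (f : R -> R -> \bar R) : Prop :=
  (forall t : R, (0 < t <= T)%R ->
     [/\ measurable_fun [set: measurableTypeR R]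
         (f t),
         (forall x, 0 <= f t x) &
         (forall B : set (measurableTypeR R), measurable B ->
            P [set w | B (X t w)] = \int[lebesgue_measure]_(x in B) f t x)]) /\
  (forall s t x : R, (0 < s)%R -> (s < t)%R -> (t <= T)%R ->
     f t x = \int[lebesgue_measure]_y (f (t - s)%R (x - y)%R * f s y)).

(* For l = [:: (t_1, x_1); ...; (t_k, x_k)] with 0 < t_1 < ... < t_k < T,
   bridge_cdf f T 0 0 l z is
     P(X_(t_1) <= x_1, ..., X_(t_k) <= x_k | X_T = z),
   i.e. the integral over {y_1 <= x_1, ..., y_k <= x_k} of
     prod_i f_(t_i - t_(i-1))(y_i - y_(i-1)) f_(T - t_k)(z - y_k) / f_T(z),
   where t_0 = 0 and y_0 = 0.  The arguments s and y are the time and position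
   reached so far. *)
Fixpoint bridge_cdf (R : realType) (f : R -> R -> \bar R) (T s y : R)
    (l : seq (R * R)) (z : R) {struct l} : \bar R :=
  if l is (t, x) :: l' then
    \int[lebesgue_measure]_(v in `]-oo, x])
      (f (t - s)%R (v - y)%R * bridge_cdf f T t v l' z)
  else f (T - s)%R (z - y)%R / f T z.

(* g is a version of z |-> P(A | Z = z), where mu is the law of Z *)
Definition is_cond_prob (R : realType) (d : measure_display)
    (Omega : measurableType d) (P : probability Omega R)
    (mu : probability (measurableTypeR R) R)
    (A : set Omega) (Z : Omega -> R) (g : R -> \bar R) : Prop :=
  measurable_fun [set: measurableTypeR R] g /\
  forall B : set (measurableTypeR R), measurable B ->
    P (A `&` Z @^-1` B) = \int[mu]_(z in B) g z.

(* The reference Levy process may live on another probability space: only its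
   densities matter. *)
Definition levy_random_bridge (R : realType) (d : measure_display)
    (Omega : measurableType d) (P : probability Omega R) (T : R)
    (nu : probability (measurableTypeR R) R) (L : R -> Omega -> R) : Prop :=
  [/\ (0 < T)%R, cadlag_process `[0%R, T] L &
  exists (d' : measure_display) (Omega' : measurableType d')
      (Q : probability Omega' R) (X : R -> Omega' -> R) (f : R -> R -> \bar R),
  [/\ levy_process Q X,
      levy_densities Q X T f,
      {ae nu, forall z : R, 0 < f T z < +oo},
      (forall B : set (measurableTypeR R), measurable B ->
         P (L T @^-1` B) = nu B) &
      (forall l : seq (R * R),
         l != [::] -> path <%R 0%R (map fst l) -> all (fun p => p.1 < T)%R l ->
         is_cond_prob P nu
           [set w | forall p, p \in l -> (L p.1 w <= p.2)%R]
           (L T) (bridge_cdf f T 0%R 0%R l))]].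

(* u_(i-1) = m_1 + ... + m_(i-1) when the coordinate i is numbered from 1 *)
Definition block_start (R : realType) (n : nat) (m : 'rV[R]_n) (i : 'I_n) : R :=
  (\sum_(j < n | (j < i)%N) m ord0 j)%R.

(* For n >= 2 and m with positive coordinates *)
Definition generalised_liouville_process (R : realType) (d : measure_display)
    (Omega : measurableType d) (P : probability Omega R) (n : nat)
    (nu : probability (measurableTypeR R) R) (m : 'rV[R]_n)
    (xi : R -> Omega -> 'rV[R]_n) : Prop :=
  (forall i, cadlag_process `[0%R, 1%R] (fun t w => xi t w ord0 i)) /\
  exists (d' : measure_display) (Omega' : measurableType d')
      (P' : probability Omega' R) (L : R -> Omega' -> R),
    levy_random_bridge P' (\sum_(j < n) m ord0 j)%R nu L /\
    eq_in_law P P' `[0%R, 1%R] xi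
      (fun t w => \row_(i < n)
         (L (t * m ord0 i + block_start m i) w - L (block_start m i) w)%R).

(* nu is the sum of an absolutely continuous and a discrete measure *)
Definition no_continuous_singular_part (R : realType)
    (nu : probability (measurableTypeR R) R) : Prop :=
  exists nu_ac nu_d : {measure set (measurableTypeR R) -> \bar R},
    [/\ nu_ac `<< (@lebesgue_measure R),
        (exists2 D : set (measurableTypeR R), countable D & nu_d (~` D) = 0) &
        (forall A : set (measurableTypeR R), measurable A ->
           nu A = nu_ac A + nu_d A)].

(* Main.v *)
Require Import Defs.
From HB Require Import structures.
From mathcomp Require Import all_boot all_order all_algebra.
From mathcomp Require Import all_classical all_reals all_analysis.
From mathcomp Require Import measurable_realfun.
From mathcomp Require Import ring lra.

(** Write [u_i = m_1 + ... + m_i] and [T = u_n], so that the [i]-th coordinate of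
    the process at time [t] is the increment of a bridge [L] over
    [(u_(i-1), u_(i-1) + t m_i)], the beginning of the [i]-th block.

    Everything rests on a reflection principle ([bridge_reflection]).  Let
    [0 <= s <= u <= T].  Given the bridge outside [(s, u)], its increments over
    [(s, s + h)] and over [(u - h, u)] have the same law.  Indeed, between a
    position [y] at time [s] and a position [w] at time [u], the position [x] at
    time [s + h] has a density proportional to
    [f_h (x - y) f_(u - s - h) (w - x)], and the map [x -> y + w - x], which
    preserves Lebesgue measure, exchanges the two factors ([bridge_int_swap]).
    To turn this into a statement on the bridge, its law at finitely many times
    is realised on the space of paths as a nested integral ([sampled_law]).  The
    reflection of two increments at the origin also shows that a bridge starts
    at [0] almost surely ([bridge_starts_at_0]).

    Harness property of the bridge ([bridge_harness]).  Let [A] be an event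
    depending on the bridge outside [(s, t)], and let [phi h] be the expectation
    of [L_(s+h) - L_s] on [A].  By reflection over [(s, s + x + y)], the increment
    over [(s + x, s + x + y)] may be replaced by the one over [(s, s + y)], so
    [phi] is additive.  As it is also measurable, it is linear
    ([additive_measurable_linear]): [phi h] is [h / (t - s)] times the expectation
    of [L_t - L_s] on [A].

    Integrability ([integrable_from_origin]).  Only the sum of the coordinates is
    assumed to be integrable.  Reflections move the beginnings of the blocks one
    after the other next to the origin without changing the law of their sum
    ([gathered_step]); so the sum at time [t] has the law of [L_(t T) - L_0], and
    all the increments of the bridge are integrable.

    Conclusion.  Between two times [a < e] the [i]-th coordinate follows the bridge
    over [(s, t)], where [s = u_(i-1) + a m_i] and [t = u_(i-1) + e m_i], while the
    values of all the coordinates at times outside [(a, e)] only involve the bridge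
    outside [(s, t)] ([block_path_outside]).  The harness property of the bridge
    over [(s, t)] is thus that of the [i]-th coordinate, and it is carried over by
    equality in law ([eq_in_law_integral]).  Summing over [i] gives the property
    for the sum, because its past and future are events of the process. *)

Set Implicit Arguments.
Unset Strict Implicit.
Unset Printing Implicit Defensive.

Import Order.TTheory GRing.Theory Num.Theory.
Import numFieldNormedType.Exports.

Local Open Scope classical_set_scope.
Local Open Scope ring_scope.

(** * Paths and their coordinates *)

Definition coordinate_sets (R : realType) (J : set R) : set (set (R -> R)) :=
  [set A | exists t (B : set (measurableTypeR R)),
     [/\ J t, measurable B & A = [set p | B (p t)]]].

Local Notation path_space R := (g_sigma_algebraType (@coordinate_sets R setT)).

Definition upd (R : realType) (p : R -> R) (t v : R) : R -> R :=
  fun r => if r == t then v else p r.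

Section paths.
Local Open Scope ereal_scope.
Context {R : realType}.
Notation PS := (path_space R).
Notation RR := (measurableTypeR R).

Lemma measurable_coordinate (t : R) :
  measurable_fun [set: PS] (fun p : PS => p t : RR).
Proof.
move=> _ B mB; rewrite setTI; apply: sub_sigma_algebra.
by exists t, B; split.
Qed.

Lemma measurable_fun_path (J : set R) d (S : measurableType d)
    (X : S -> g_sigma_algebraType (coordinate_sets J)) :
  (forall t, J t -> measurable_fun [set: S] (fun w => X w t : RR)) ->
  measurable_fun [set: S] X.
Proof.
move=> mX; apply: (@measurability _ _ S (g_sigma_algebraType (coordinate_sets J))
  setT X (coordinate_sets J)) => //.
move=> _ [_ [t [B [Jt mB ->]]] <-].
exact: (mX t).
Qed.

Lemma upd_eq (q : R -> R) t v : upd q t v t = v.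
Proof. by rewrite /upd eqxx. Qed.

Lemma upd_neq (q : R -> R) t v r : r != t -> upd q t v r = q r.
Proof. by rewrite /upd => /negbTE ->. Qed.

Lemma measurable_upd (t : R) :
  measurable_fun [set: PS * RR] (fun pv : PS * RR => upd pv.1 t pv.2 : PS).
Proof.
apply: measurable_fun_path => r _; rewrite /upd.
have [_|_] := eqVneq r t; first exact: measurable_snd.
by apply: measurableT_comp (measurable_coordinate r) _; exact: measurable_fst.
Qed.

Lemma measurable_inve d (S : measurableType d) (g : S -> \bar R) :
  (forall x, 0 <= g x) -> measurable_fun setT g ->
  measurable_fun setT (fun x => (g x)^-1).
Proof.
move=> g0 mg.
rewrite (_ : (fun x => _) =
  (fun x => if g x == 0 then +oo else ((fine (g x) `^ (-1))%R)%:E)); last first.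
  apply/funext => x; have [->|gx0] := eqVneq (g x) 0; first exact: inve0.
  have := g0 x; move: gx0; case: (g x) => [r||]//= r0 r0'.
    have rn0 : r != 0%R by apply: contra_neq r0 => ->.
    by rewrite inver (negbTE rn0) powR_inv1// -lee_fin.
  (* [fine] sends infinity to [0], whose inverse is [0] on both sides. *)
  by rewrite invey powR0// oppr_eq0 oner_eq0.
apply: measurable_fun_ifT => //.
  apply: (measurable_fun_bool true) => //.
  rewrite setTI (_ : _ @^-1` _ = g @^-1` [set 0]); last first.
    by apply/seteqP; split => x /= /eqP.
  by rewrite -[X in measurable X]setTI; apply: mg => //; exact: emeasurable_set1.
apply/measurable_EFinP; apply: measurableT_comp (measurable_powR _) _.
by apply: measurableT_comp => //; exact: fine_measurable.
Qed.

Lemma ge0_nneseriesZl (c : \bar R) (a : nat -> \bar R) : 0 <= c ->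
  (forall n, 0 <= a n) -> c * \sum_(n <oo) a n = \sum_(n <oo) c * a n.
Proof.
move=> c0 a0.
rewrite -!(@ge0_integral_count R)//; last by move=> n; rewrite mule_ge0.
by rewrite ge0_integralZl.
Qed.

Definition cylinder (ts : seq R) (B : R -> set RR) : set (R -> R) :=
  [set p | forall t, t \in ts -> B t (p t)].

Lemma measurable_cylinder (J : set R) (ts : seq R) (B : R -> set RR) :
  (forall t, t \in ts -> J t) -> (forall t, measurable (B t)) ->
  <<s coordinate_sets J >> (cylinder ts B).
Proof.
move=> tsJ mB.
rewrite (_ : cylinder ts B = \bigcap_(t in [set` ts]) [set p | B t (p t)]).
  apply: (@fin_bigcap_measurable _ (g_sigma_algebraType (coordinate_sets J))) => //.
  move=> t tts; apply: sub_sigma_algebra; exists t, (B t); split => //.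
  exact: tsJ.
by apply/seteqP; split.
Qed.

Lemma measurable_increment_path (t t' : R) (B : set RR) : measurable B ->
  measurable [set p : PS | B (p t - p t')%R].
Proof.
move=> mB; have : measurable_fun setT (fun p : PS => (p t - p t')%R : RR).
  by apply: measurable_funB; exact: measurable_coordinate.
by move=> /(_ measurableT B mB); rewrite setTI.
Qed.

End paths.

(** * Integrals against the densities of a bridge *)

(** The integral of [G], against the transition densities [f], over the positions
    at the times [ts] of a bridge that has already followed [p] up to the time
    [s] and ends in [z] at time [T]; the final division makes it an expectation
    when [s] and [p s] vanish.  The positions are written into the path one after
    the other, so that [G] may be any function of the path, whatever the number
    of observation times. *)
Fixpoint bridge_int (R : realType) (f : R -> R -> \bar R) (T s : R)
    (ts : seq R) (G : (R -> R) -> \bar R) (p : R -> R) (z : R) {struct ts} :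
    \bar R :=
  if ts is t :: ts' then
    (\int[lebesgue_measure]_v
      (f (t - s)%R (v - p s)%R * bridge_int f T t ts' G (upd p t v) z))%E
  else (f (T - s)%R (z - p s)%R / f T z * G (upd p T z))%E.

Section bridge_int.
Local Open Scope ereal_scope.
Context {R : realType} (f : R -> R -> \bar R) (T : R).
Notation PS := (path_space R).
Notation RR := (measurableTypeR R).
Hypothesis mf : forall t : R, (0 < t <= T)%R ->
  measurable_fun [set: RR] (f t).
Hypothesis f0 : forall t x : R, (0 < t <= T)%R -> 0 <= f t x.

Lemma path_lt_last (s : R) (ts : seq R) :
  path <%R s (rcons ts T) -> (s < T)%R.
Proof.
elim: ts s => [|t ts IH] s /=; first by rewrite andbT.
by move=> /andP[st /IH]; exact: lt_trans.
Qed.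

Let step_gt0 (s : R) (ts : seq R) t : (0 <= s)%R ->
  path <%R s (rcons (t :: ts) T) -> [/\ (0 < t - s <= T)%R, (0 <= t)%R &
    path <%R t (rcons ts T)].
Proof.
move=> s0 /= /andP[st pt]; have tT := path_lt_last pt.
split => //; last exact: le_trans s0 (ltW st).
rewrite subr_gt0 st/= lerBlDr (le_trans (ltW tT))//.
by rewrite lerDl.
Qed.

Lemma bridge_int_ge0 (G : (R -> R) -> \bar R) (s : R) (ts : seq R) p z :
  (0 <= s)%R -> path <%R s (rcons ts T) -> (forall q, 0 <= G q) ->
  0 <= bridge_int f T s ts G p z.
Proof.
elim: ts s p => [|t ts IH] s p s0 pts G0 /=.
  have sT : (s < T)%R by exact: (@path_lt_last s [::]).
  have T0 : (0 < T)%R by exact: le_lt_trans s0 sT.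
  apply: mule_ge0 => //; apply: mule_ge0.
    by apply: f0; rewrite subr_gt0 sT/= gerBl.
  by rewrite inve_ge0 f0// lexx T0.
have [h1 h2 h3] := step_gt0 s0 pts.
apply: integral_ge0 => v _; apply: mule_ge0; first exact: f0.
exact: IH.
Qed.

Lemma measurable_increment d (S : measurableType d) (X Y : S -> RR) (t : R) :
  (0 < t <= T)%R -> measurable_fun setT X -> measurable_fun setT Y ->
  measurable_fun setT (fun w => f t (X w - Y w)%R).
Proof.
move=> t0 mX mY; apply: measurableT_comp; first exact: mf.
exact: measurable_funB.
Qed.

(** Joint measurability in the path and the end point is what makes the
    induction on the number of times go through, by Tonelli's theorem. *)
Lemma measurable_bridge_int (G : PS -> \bar R) (s : R) (ts : seq R) :
  (0 <= s)%R -> path <%R s (rcons ts T) ->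
  measurable_fun setT G -> (forall q, 0 <= G q) ->
  measurable_fun [set: PS * RR]
    (fun pz : PS * RR => bridge_int f T s ts G pz.1 pz.2).
Proof.
move=> + + mG G0.
elim: ts s => [|t ts IH] s s0 pts /=.
  have sT : (s < T)%R by exact: (@path_lt_last s [::]).
  have T0 : (0 < T)%R by exact: le_lt_trans s0 sT.
  apply: emeasurable_funM; last first.
    exact: (measurableT_comp mG (measurable_upd T)).
  apply: emeasurable_funM.
    apply: measurable_increment; [|exact: measurable_snd|].
      by rewrite subr_gt0 sT/= gerBl.
    exact: (measurableT_comp (measurable_coordinate s) measurable_fst).
  apply: measurable_inve => [x|]; first by rewrite f0// lexx T0.
  apply: measurableT_comp; last exact: measurable_snd.
  by apply: mf; rewrite lexx T0.
have [h1 h2 h3] := step_gt0 s0 pts.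
apply: (@measurable_fun_fubini_tonelli_F _ _ _ _ _ lebesgue_measure
  (fun pzv : (PS * RR) * RR => f (t - s)%R (pzv.2 - pzv.1.1 s)%R *
     bridge_int f T t ts G (upd pzv.1.1 t pzv.2) pzv.1.2)).
  apply: emeasurable_funM.
    apply: (@measurable_increment _ _
      (fun pzv : (PS * RR) * RR => pzv.2) (fun pzv => pzv.1.1 s)) => //.
      exact: measurable_snd.
    apply: (measurableT_comp (measurable_coordinate s)
      (g := fun pzv : (PS * RR) * RR => pzv.1.1)).
    exact: measurableT_comp measurable_fst measurable_fst.
  apply: (measurableT_comp (IH _ h2 h3)
    (g := fun pzv : (PS * RR) * RR => (upd pzv.1.1 t pzv.2 : PS, pzv.1.2))).
  apply: measurable_fun_pair; last first.
    exact: measurableT_comp measurable_snd measurable_fst.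
  apply: (measurableT_comp (measurable_upd t)
    (g := fun pzv : (PS * RR) * RR => (pzv.1.1, pzv.2))).
  apply: measurable_fun_pair; last exact: measurable_snd.
  exact: measurableT_comp measurable_fst measurable_fst.
by move=> [[p z] v] /=; apply: mule_ge0; [exact: f0|exact: bridge_int_ge0].
Qed.

Lemma measurable_bridge_int_integrand (G : PS -> \bar R) (s t : R)
    (ts : seq R) (p : PS) (z : R) :
  (0 <= s)%R -> path <%R s (rcons (t :: ts) T) ->
  measurable_fun setT G -> (forall q, 0 <= G q) ->
  measurable_fun [set: RR]
    (fun v : RR => f (t - s)%R (v - p s)%R *
       bridge_int f T t ts G (upd p t v) z).
Proof.
move=> s0 pts mG G0; have [h1 h2 h3] := step_gt0 s0 pts.
apply: emeasurable_funM; first exact: measurable_increment.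
apply: (measurableT_comp (measurable_bridge_int h2 h3 mG G0)
    (g := fun v : RR => (upd p t v : PS, z : RR))).
apply: measurable_fun_pair => //.
apply: (measurableT_comp (measurable_upd t) (g := fun v : RR => (p, v))).
exact: measurable_fun_pair.
Qed.

Lemma bridge_int_nneseries (G : nat -> PS -> \bar R) (s : R) (ts : seq R) p z :
  (0 <= s)%R -> path <%R s (rcons ts T) ->
  (forall n, measurable_fun setT (G n)) -> (forall n q, 0 <= G n q) ->
  bridge_int f T s ts (fun q => \sum_(n <oo) G n q) p z =
  \sum_(n <oo) bridge_int f T s ts (G n) p z.
Proof.
move=> + + mG G0.
elim: ts s p => [|t ts IH] s p s0 pts /=.
  have sT : (s < T)%R by exact: (@path_lt_last s [::]).
  have T0 : (0 < T)%R by exact: le_lt_trans s0 sT.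
  rewrite ge0_nneseriesZl//; apply: mule_ge0.
    by apply: f0; rewrite subr_gt0 sT/= gerBl.
  by rewrite inve_ge0 f0// lexx T0.
have [h1 h2 h3] := step_gt0 s0 pts.
rewrite -integral_nneseries//; last 2 first.
- by move=> n; exact: measurable_bridge_int_integrand.
- by move=> n v _; apply: mule_ge0; [exact: f0|exact: bridge_int_ge0].
apply: eq_integral => v _; rewrite IH// ge0_nneseriesZl//; first exact: f0.
by move=> n; exact: bridge_int_ge0.
Qed.

(** Two integrals over the same times agree when their integrands agree along
    the paths that can be reached: these keep the values of the starting paths
    away from the times still to be visited, and share the visited values. *)
Lemma bridge_int_congr (G G' : (R -> R) -> \bar R) (s : R) (ts : seq R) p p' z :
  path <%R s (rcons ts T) -> p s = p' s ->
  (forall q q', (forall r, r \notin rcons ts T -> q r = p r) ->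
     (forall r, r \notin rcons ts T -> q' r = p' r) ->
     (forall r, r \in rcons ts T -> q r = q' r) -> q T = z -> G q = G' q') ->
  bridge_int f T s ts G p z = bridge_int f T s ts G' p' z.
Proof.
elim: ts s p p' => [|t ts IH] s p p' pts pp' GG' /=.
  rewrite pp'//; congr (_ * _); apply: GG'; rewrite /upd ?eqxx//.
  - by move=> r; rewrite inE => /negbTE ->.
  - by move=> r; rewrite inE => /negbTE ->.
  - by move=> r; rewrite inE => /eqP ->; rewrite eqxx.
apply: eq_integral => v _; rewrite pp'//; congr (_ * _).
move: pts => /= /andP[st pts].
have tts : t \notin rcons ts T.
  apply/negP => /(allP (order_path_min lt_trans pts)).
  by rewrite ltxx.
apply: IH => //; first by rewrite /upd !eqxx.
move=> q q' qp qp' qq' qz; apply: GG' => //.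
- by move=> r; rewrite inE negb_or => /andP[/negbTE rt] /qp ->; rewrite /upd rt.
- by move=> r; rewrite inE negb_or => /andP[/negbTE rt] /qp' ->; rewrite /upd rt.
- move=> r; rewrite inE => /predU1P[->|/qq'//].
  by rewrite qp// qp'// /upd eqxx.
Qed.

End bridge_int.

(** * Exchanging two successive increments *)

Section lebesgue_reflection.
Local Open Scope ereal_scope.

Lemma ge0_integral_reflection (R : realType) (c : R) (g : R -> \bar R) :
  measurable_fun [set: measurableTypeR R] g -> (forall x, 0 <= g x) ->
  \int[lebesgue_measure]_x g (c - x)%R = \int[lebesgue_measure]_x g x.
Proof.
move=> mg g0.
pose h : measurableTypeR R -> measurableTypeR R := fun x => (c - x)%R.
have mh : measurable_fun setT h by exact: measurable_funB.
have hE A : measurable A -> lebesgue_measure A =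
    pushforward (@lebesgue_measure R) h A.
  move=> mA.
  apply: (@lebesgue_measure_unique R (pushforward (@lebesgue_measure R) h)) => //.
  move=> _ [[a b]] _ <-.
  change (lebesgue_measure `]a, b]%classic =
    lebesgue_measure (h @^-1` `]a, b]%classic)).
  have -> : h @^-1` `]a, b]%classic = `[(c - b)%R, (c - a)%R[%classic.
    apply/seteqP; split => x /=; rewrite /h/= !in_itv/= => /andP[x1 x2].
      by apply/andP; split; [rewrite lerBlDr -lerBlDl|rewrite ltrBrDr -ltrBrDl].
    by apply/andP; split; [rewrite ltrBrDr -ltrBrDl|rewrite lerBlDr -lerBlDl].
  rewrite !lebesgue_measure_itv/= !lte_fin.
  rewrite (_ : (c - b < c - a)%R = (a < b)%R); last by apply/idP/idP; lra.
  by case: ifPn => // _; rewrite -!EFinB; congr EFin; lra.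
rewrite -(ge0_integral_pushforward (phi := h) mh _ measurableT (f := g))//.
by apply: eq_measure_integral => A mA _; exact/esym/hE.
Qed.

End lebesgue_reflection.

Section swap.
Local Open Scope ereal_scope.
Context {R : realType} (f : R -> R -> \bar R) (T : R).
Notation PS := (path_space R).
Notation RR := (measurableTypeR R).
Hypothesis mf : forall t : R, (0 < t <= T)%R ->
  measurable_fun [set: RR] (f t).
Hypothesis f0 : forall t x : R, (0 < t <= T)%R -> 0 <= f t x.

Lemma measurable_two_steps (G : PS -> \bar R) (s a u : R) (ts : seq R)
    (p : PS) (z : R) :
  (0 <= s)%R -> path <%R s (rcons (a :: u :: ts) T) ->
  measurable_fun setT G -> (forall q, 0 <= G q) ->
  measurable_fun [set: RR * RR] (fun xw : RR * RR =>
    f (a - s)%R (xw.1 - p s)%R * (f (u - a)%R (xw.2 - xw.1)%R *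
      bridge_int f T u ts G (upd (upd p a xw.1) u xw.2) z)).
Proof.
move=> s0 /= /and3P[sa au pu] mG G0; have uT := path_lt_last pu.
have m1 : measurable_fun [set: RR * RR]
    (fun xw : RR * RR => f (a - s)%R (xw.1 - p s)%R).
  apply: (measurable_increment mf (X := fun xw : RR * RR => xw.1)
    (Y := fun=> p s)) => //.
    by apply/andP; split; lra.
  exact: measurable_fst.
have m2 : measurable_fun [set: RR * RR]
    (fun xw : RR * RR => f (u - a)%R (xw.2 - xw.1)%R).
  apply: (measurable_increment mf (X := fun xw : RR * RR => xw.2)
    (Y := fun xw : RR * RR => xw.1)) => //.
  - by apply/andP; split; lra.
  - exact: measurable_snd.
  - exact: measurable_fst.
refine (emeasurable_funM m1 (emeasurable_funM m2 _)).
have u0 : (0 <= u)%R by lra.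
apply: (measurableT_comp (measurable_bridge_int mf f0 u0 pu mG G0)
    (g := fun xw : RR * RR => (upd (upd p a xw.1) u xw.2 : PS, z : RR))).
apply: measurable_fun_pair => //.
apply: (measurableT_comp (measurable_upd u)
    (g := fun xw : RR * RR => (upd p a xw.1 : PS, xw.2))).
apply: measurable_fun_pair; last exact: measurable_snd.
apply: (measurableT_comp (measurable_upd a)
    (g := fun xw : RR * RR => (p, xw.1))).
by apply: measurable_fun_pair => //; exact: measurable_fst.
Qed.

Lemma two_steps_ge0 (G : PS -> \bar R) (s a u : R) (ts : seq R)
    (p : PS) (z x w : R) :
  (0 <= s)%R -> path <%R s (rcons (a :: u :: ts) T) ->
  (forall q, 0 <= G q) ->
  0 <= f (a - s)%R (x - p s)%R * (f (u - a)%R (w - x)%R *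
      bridge_int f T u ts G (upd (upd p a x) u w) z).
Proof.
move=> s0 /= /and3P[sa au pu] G0; have uT := path_lt_last pu.
apply: mule_ge0; first by apply: f0; apply/andP; split; lra.
apply: mule_ge0; first by apply: f0; apply/andP; split; lra.
by apply: bridge_int_ge0 => //; lra.
Qed.

Lemma bridge_int_two_steps (G : PS -> \bar R) (s a u : R) (ts : seq R)
    (p : PS) (z : R) :
  (0 <= s)%R -> path <%R s (rcons (a :: u :: ts) T) ->
  measurable_fun setT G -> (forall q, 0 <= G q) ->
  bridge_int f T s (a :: u :: ts) G p z =
  \int[lebesgue_measure]_w \int[lebesgue_measure]_x
    (f (a - s)%R (x - p s)%R * (f (u - a)%R (w - x)%R *
      bridge_int f T u ts G (upd (upd p a x) u w) z)).
Proof.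
move=> s0 pu mG G0.
have sa : (s < a)%R by case/andP: pu.
have pa : path <%R a (rcons (u :: ts) T) by case/andP: pu.
have aT := path_lt_last pa.
transitivity (\int[lebesgue_measure]_x \int[lebesgue_measure]_w
    (f (a - s)%R (x - p s)%R * (f (u - a)%R (w - x)%R *
      bridge_int f T u ts G (upd (upd p a x) u w) z))); last first.
  apply: (@fubini_tonelli _ _ _ _ _ lebesgue_measure lebesgue_measure
   (fun xw : RR * RR =>
    f (a - s)%R (xw.1 - p s)%R * (f (u - a)%R (xw.2 - xw.1)%R *
      bridge_int f T u ts G (upd (upd p a xw.1) u xw.2) z))).
    exact: measurable_two_steps.
  by move=> xw; exact: two_steps_ge0.
apply: eq_integral => x _.
have := @measurable_bridge_int_integrand _ _ _ mf f0 G a u ts (upd p a x) z.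
rewrite [LHS]/= upd_eq => mI.
rewrite ge0_integralZl//.
- by apply: mI => //; lra.
- move=> w _; case/andP: pa => au pu'; have uT := path_lt_last pu'.
  apply: mule_ge0; first by apply: f0; apply/andP; split; lra.
  by apply: bridge_int_ge0 => //; lra.
- by apply: f0; apply/andP; split; lra.
Qed.

(** A bridge at [y] at time [s] and at [w] at time [u] is at [x] at time [m] with
    density proportional to [f (m - s) (x - y) * f (u - m) (w - x)].  The
    reflection [x -> y + w - x] exchanges the two factors, that is, it turns the
    intermediate time [m] into the time [m'] at the same distance of [u] as
    [m] is of [s], and the increment from [s] to [m] into the increment from
    [m'] to [u].  The value at [u] is that at [T], known to be [z], when there
    is no further time. *)
Lemma bridge_int_swap_head (G G' : PS -> \bar R) (s m m' : R) (ts : seq R) p z :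
  (0 <= s)%R ->
  path <%R s (rcons (m :: ts) T) -> path <%R s (rcons (m' :: ts) T) ->
  (m - s = head T ts - m')%R ->
  measurable_fun setT G -> (forall q, 0 <= G q) ->
  measurable_fun setT G' -> (forall q, 0 <= G' q) ->
  (forall p q : R -> R, (forall r, (r <= s \/ head T ts <= r)%R -> p r = q r) ->
     (p m - p s = q (head T ts) - q m')%R -> G p = G' q) ->
  bridge_int f T s (m :: ts) G p z = bridge_int f T s (m' :: ts) G' p z.
Proof.
move=> s0 pm pm' E mG G0 mG' G'0 GG'.
have sm : (s < m)%R by case/andP: pm.
have sm' : (s < m')%R by case/andP: pm'.
case: ts => [|u ts] in pm pm' E GG' *.
  rewrite [LHS]/= -(ge0_integral_reflection (p s + z)%R); last 2 first.
  - exact: (@measurable_bridge_int_integrand _ _ _ mf f0 G s m [::] p z).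
  - move=> x; rewrite -/(bridge_int f T m [::] G (upd p m x) z).
    case/andP: pm => _ pm; have mT : (m < T)%R by case/andP: pm.
    apply: mule_ge0; first by apply: f0; apply/andP; split; lra.
    by apply: bridge_int_ge0 => //; lra.
  have mT : (m < T)%R by case/and3P: pm.
  have mT' : (m' < T)%R by case/and3P: pm'.
  rewrite /= in E.
  rewrite [RHS]/=; apply: eq_integral => x _.
  rewrite !upd_eq muleCA -!muleA.
  rewrite (_ : T - m = m' - s)%R; last lra.
  rewrite (_ : z - (p s + z - x) = x - p s)%R; last lra.
  rewrite (_ : T - m' = m - s)%R; last lra.
  rewrite (_ : p s + z - x - p s = z - x)%R; last lra.
  congr (_ * _); rewrite muleCA; congr (_ * (_ * _)).
  apply: GG' => /=.
    move=> r Hr; have [->|rT] := eqVneq r T; first by rewrite !upd_eq.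
    rewrite !upd_neq//; case: Hr => Hr; apply/eqP; lra.
  have mNT : m != T by apply/eqP; lra.
  have sNT : s != T by apply/eqP; lra.
  have sNm : s != m by apply/eqP; lra.
  have m'NT : m' != T by apply/eqP; lra.
  rewrite (upd_neq _ _ mNT) (upd_neq _ _ sNT) (upd_neq _ _ sNm).
  rewrite (upd_neq _ _ m'NT) !upd_eq; lra.
have [mu um'] : (m < u /\ m' < u)%R by case/and3P: pm; case/and3P: pm'.
have uT : (u < T)%R.
  by move: pm => /= /and3P[_ _]; exact: path_lt_last.
rewrite /= in E GG'.
rewrite (bridge_int_two_steps p z s0 pm mG G0).
rewrite (bridge_int_two_steps p z s0 pm' mG' G'0).
apply: eq_integral => w _.
rewrite -(ge0_integral_reflection (p s + w)%R); last 2 first.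
- apply: (measurableT_comp (@measurable_two_steps G s m u ts p z s0 pm mG G0)
    (g := fun x : RR => (x, w))).
  exact: measurable_fun_pair.
- by move=> x; exact: two_steps_ge0.
apply: eq_integral => x _.
rewrite (_ : u - m = m' - s)%R; last lra.
rewrite (_ : w - (p s + w - x) = x - p s)%R; last lra.
rewrite (_ : u - m' = m - s)%R; last lra.
rewrite (_ : p s + w - x - p s = w - x)%R; last lra.
rewrite muleCA; congr (_ * (_ * _)).
have pu : path <%R u (rcons ts T) by case/and3P: pm.
have gt_notin r : (r <= u)%R -> r \notin rcons ts T.
  move=> ru; apply/negP => /(allP (order_path_min lt_trans pu)).
  by rewrite ltNge ru.
apply: bridge_int_congr => //; first by rewrite !upd_eq.
move=> q q' qE q'E qq' _; apply: GG'.
  move=> r Hr; have [/qq'//|rts] := boolP (r \in rcons ts T).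
  rewrite qE// q'E//.
  have [->|ru] := eqVneq r u; first by rewrite !upd_eq.
  rewrite !upd_neq//; case: Hr => Hr; apply/eqP; lra.
have mNu : m != u by apply/eqP; lra.
have sNu : s != u by apply/eqP; lra.
have sNm : s != m by apply/eqP; lra.
have m'Nu : m' != u by apply/eqP; lra.
rewrite !qE ?q'E; try by apply: gt_notin; lra.
rewrite (upd_neq _ _ mNu) (upd_neq _ _ sNu) (upd_neq _ _ sNm).
rewrite (upd_neq _ _ m'Nu) !upd_eq; lra.
Qed.

(** The positions at the times before [s] are integrated last, and in the same
    way on both sides. *)
Lemma bridge_int_swap (G G' : PS -> \bar R) (s0 s m m' u : R)
    (ts1 ts2 : seq R) p z :
  (0 <= s0)%R -> last s0 ts1 = s -> head T ts2 = u ->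
  path <%R s0 (rcons (ts1 ++ m :: ts2) T) ->
  path <%R s0 (rcons (ts1 ++ m' :: ts2) T) ->
  (m - s = u - m')%R ->
  measurable_fun setT G -> (forall q, 0 <= G q) ->
  measurable_fun setT G' -> (forall q, 0 <= G' q) ->
  (forall p q : R -> R, (forall r, (r <= s \/ u <= r)%R -> p r = q r) ->
     (p m - p s = q u - q m')%R -> G p = G' q) ->
  bridge_int f T s0 (ts1 ++ m :: ts2) G p z =
  bridge_int f T s0 (ts1 ++ m' :: ts2) G' p z.
Proof.
move=> + + <-; elim: ts1 s0 p => [|t ts1 IH] s0 p s00.
  by move=> <- *; exact: bridge_int_swap_head.
move=> lE pm pm' *; rewrite !cat_cons [LHS]/= [RHS]/=.
move: pm pm' => /= /andP[st pm] /andP[_ pm'].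
apply: eq_integral => v _; congr (_ * _); apply: IH => //.
exact: le_trans s00 (ltW st).
Qed.

End swap.

(** * Finite-dimensional laws of a bridge *)

Section law.
Local Open Scope ereal_scope.
Context {R : realType} (f : R -> R -> \bar R) (T : R).
Notation PS := (path_space R).
Notation RR := (measurableTypeR R).
Hypothesis mf : forall t : R, (0 < t <= T)%R ->
  measurable_fun [set: RR] (f t).
Hypothesis f0 : forall t x : R, (0 < t <= T)%R -> 0 <= f t x.

Definition bridge_law (nu : probability RR R) (ts : seq R) (A : set PS) :
    \bar R :=
  \int[nu]_z bridge_int f T 0%R ts (fun q => (\1_A q)%:E) (cst 0%R) z.

Lemma measurable_indicE (A : set PS) : measurable A ->
  measurable_fun [set: PS] (fun q : PS => (\1_A q)%:E : \bar R).
Proof. by move=> mA; apply/measurable_EFinP; exact: measurable_indic. Qed.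

Lemma indicE_ge0 (A : set PS) q : 0 <= (\1_A q)%:E :> \bar R.
Proof. by rewrite lee_fin indicE. Qed.

Lemma measurable_bridge_int_z (ts : seq R) (G : PS -> \bar R) (p : PS) :
  path <%R 0%R (rcons ts T) -> measurable_fun setT G -> (forall q, 0 <= G q) ->
  measurable_fun [set: RR] (fun z : RR => bridge_int f T 0%R ts G p z).
Proof.
move=> pts mG G0.
apply: (measurableT_comp (measurable_bridge_int mf f0 (lexx 0%R) pts mG G0)
    (g := fun z : RR => (p, z))).
exact: measurable_fun_pair.
Qed.

Lemma bridge_int0 (s : R) (ts : seq R) p z :
  bridge_int f T s ts (fun=> 0) p z = 0.
Proof.
elim: ts s p => [|t ts IH] s p /=; first by rewrite mule0.
by apply: integral0_eq => v _; rewrite IH mule0.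
Qed.

Lemma bridge_law_measure (nu : probability RR R) (ts : seq R) :
  path <%R 0%R (rcons ts T) ->
  exists mu : {measure set PS -> \bar R},
    forall A, measurable A -> mu A = bridge_law nu ts A.
Proof.
move=> pts.
pose M (A : set PS) := bridge_law nu ts A.
have M0 : M set0 = 0.
  rewrite /M /bridge_law integral0_eq// => z _.
  by rewrite -[RHS](bridge_int0 0%R ts (cst 0%R) z); apply: bridge_int_congr => // q q' _ _ _ _;
    rewrite indicE in_set0.
have Mge0 A : 0 <= M A.
  by apply: integral_ge0 => z _; exact: bridge_int_ge0.
have Msigma : semi_sigma_additive M.
  move=> F mF tF mUF.
  have -> : M (\bigcup_n F n) = \sum_(n <oo) M (F n).
    rewrite /M /bridge_law -integral_nneseries//; last 2 first.
    - move=> n; apply: measurable_bridge_int_z => //.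
      exact: measurable_indicE.
    - by move=> n z _; exact: bridge_int_ge0.
    apply: eq_integral => z _.
    rewrite -(bridge_int_nneseries mf f0 (G := fun n q => (\1_(F n) q)%:E))//;
      last by move=> n; exact: measurable_indicE.
    apply: bridge_int_congr => // q q' qz q'z qq' _.
    have <- : q = q'.
      apply/funext => r; have [/qq'//|rN] := boolP (r \in rcons ts T).
      by rewrite qz// q'z.
    apply/esym/cvg_lim => //.
    exact: (@measure_semi_sigma_additive _ _ _ (@dirac _ PS q R)).
  by apply: is_cvg_nneseries => n _ _; exact: Mge0.
pose mix := isMeasure.Build _ PS R M M0 Mge0 Msigma.
pose mu : {measure set PS -> \bar R} := HB.pack M mix.
by exists mu.
Qed.

Definition box (x : R -> R) (ts : seq R) : set (R -> R) :=
  [set p | forall t, t \in ts -> (p t <= x t)%R].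

(** On boxes the integral is the conditional distribution function that defines
    a bridge. *)
Lemma bridge_int_box (x : R -> R) (s : R) (ts : seq R) p z :
  path <%R s (rcons ts T) ->
  bridge_int f T s ts (fun q => (\1_(box x ts) q)%:E) p z =
  bridge_cdf f T s (p s) [seq (t, x t) | t <- ts] z.
Proof.
elim: ts s p => [|t ts IH] s p pts /=.
  by rewrite indicE mem_set ?mule1.
move: pts => /= /andP[st pts].
have tts : t \notin rcons ts T.
  apply/negP => /(allP (order_path_min lt_trans pts)).
  by rewrite ltxx.
rewrite [RHS]integral_mkcond; apply: eq_integral => v _; rewrite patchE.
rewrite (_ : (v \in _) = (v <= x t)%R); last first.
  by apply/idP/idP; rewrite inE /= in_itv.
case: ifPn => vx.
  have := IH t (upd p t v) pts; rewrite upd_eq => <-; congr (_ * _).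
  apply: bridge_int_congr => // q q' qp q'p qq' _.
  have -> : q = q'.
    apply/funext => r; have [/qq'//|rN] := boolP (r \in rcons ts T).
    by rewrite qp// q'p.
  congr (_%:E); rewrite !indicE; congr (_%:R); apply: (congr1 nat_of_bool).
  apply/idP/idP; rewrite !inE => Hb r rts; first by apply: Hb; rewrite inE rts orbT.
  move: rts; rewrite inE => /predU1P[->|/Hb//].
  by rewrite q'p// upd_eq.
rewrite -[RHS](mule0 (f (t - s)%R (v - p s)%R)); congr (_ * _).
rewrite -[RHS](bridge_int0 t ts (upd p t v) z).
apply: bridge_int_congr => // q q' qp _ _ _.
rewrite indicE memNset//= => /(_ t); rewrite mem_head => /(_ isT).
by rewrite qp// upd_eq; apply/negP.
Qed.

Lemma measurable_box (x : R -> R) (ts : seq R) : measurable (box x ts : set PS).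
Proof.
rewrite (_ : box x ts = \bigcap_(t in [set` ts])
   ((fun p : PS => p t : RR) @^-1` `]-oo, x t]%classic)); last first.
  by apply/seteqP; split => p /= Hp t /Hp; rewrite /= in_itv.
apply: fin_bigcap_measurable => // t _.
rewrite -[X in measurable X]setTI; apply: measurable_coordinate => //.
Qed.

(** The values of a path at times other than the observed ones are replaced by
    the value [0] from which [bridge_law] starts. *)
Definition sampled (ts : seq R) (p : R -> R) : R -> R :=
  fun t => if t \in rcons ts T then p t else 0%R.

Lemma sampledK (ts : seq R) (p : R -> R) :
  sampled ts (sampled ts p) = sampled ts p.
Proof. by apply/funext => t; rewrite /sampled; case: ifP => // ->. Qed.

Lemma box_cover (ts : seq R) (p : R -> R) :
  exists n : nat, box (fun=> n%:R) ts p.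
Proof.
pose b : R := (\sum_(t <- ts) `|p t|)%R.
exists (Num.truncn b).+1 => t tts.
apply: ltW; apply: le_lt_trans (truncnS_gt b).
rewrite (le_trans (ler_norm _))// /b (big_rem t)//= lerDl.
exact: sumr_ge0.
Qed.

Lemma bridge_law_box (nu : probability RR R) (ts : seq R) (x : R -> R)
    (B : set RR) : path <%R 0%R (rcons ts T) ->
  bridge_law nu ts (box x ts `&` [set p | B (p T)]) =
  \int[nu]_(z in B) bridge_cdf f T 0%R 0%R [seq (t, x t) | t <- ts] z.
Proof.
move=> pts; rewrite [RHS]integral_mkcond; apply: eq_integral => z _.
rewrite patchE; case: ifPn => zB.
  rewrite -(bridge_int_box _ (cst 0%R))//.
  apply: bridge_int_congr => // q q' qp q'p qq' qz.
  have <- : q = q'.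
    apply/funext => r; have [/qq'//|rN] := boolP (r \in rcons ts T).
    by rewrite qp// q'p.
  congr (_%:E); rewrite !indicE; congr (_%:R); apply: (congr1 nat_of_bool).
  rewrite inE in zB.
  by apply/idP/idP; rewrite !inE/= qz => // -[].
rewrite -[RHS](bridge_int0 0%R ts (cst 0%R) z).
apply: bridge_int_congr => // q q' _ _ _ qz.
rewrite indicE memNset//= qz => -[_ /mem_set].
exact/negP.
Qed.

Lemma measurable_sampled d (S : measurableType d) (L : R -> S -> R)
    (ts : seq R) :
  (forall t, t \in rcons ts T -> measurable_fun setT (L t : S -> RR)) ->
  measurable_fun [set: S] (fun w => sampled ts (L ^~ w) : PS).
Proof.
move=> mL; apply: measurable_fun_path => t _; rewrite /sampled.
by have [/mL|_] := boolP (t \in rcons ts T); [|exact: measurable_cst].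
Qed.

Lemma path_rcons_bounds (s t : R) (ts : seq R) :
  path <%R s (rcons ts T) -> t \in ts -> (s < t < T)%R.
Proof.
move=> pts tts; rewrite (allP (order_path_min lt_trans pts))/=; last first.
  by rewrite mem_rcons inE tts orbT.
move: pts; rewrite (path_sortedE lt_trans) => /andP[_].
by rewrite (sorted_pairwise lt_trans) pairwise_rcons => /andP[/allP/(_ _ tts)].
Qed.

(** A bridge is only given by its distribution functions, that is, on boxes.
    These determine the law on all events of path space, since both sides are
    finite measures there. *)
Lemma sampled_law d (Omega : measurableType d) (P : probability Omega R)
    (nu : probability RR R) (L : R -> Omega -> R) (ts : seq R) (A : set PS) :
  ts != [::] -> path <%R 0%R (rcons ts T) ->
  (forall t, (0 < t <= T)%R -> measurable_fun setT (L t : Omega -> RR)) ->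
  (forall l : seq (R * R),
     l != [::] -> path <%R 0%R (map fst l) -> all (fun p => p.1 < T)%R l ->
     is_cond_prob P nu [set w | forall p, p \in l -> (L p.1 w <= p.2)%R]
       (L T) (bridge_cdf f T 0%R 0%R l)) ->
  measurable A ->
  P [set w | A (sampled ts (L ^~ w))] = bridge_law nu ts A.
Proof.
move=> ts0 pts mL HL mA.
have T0 : (0 < T)%R := path_lt_last pts.
have range_ts t : t \in rcons ts T -> (0 < t <= T)%R.
  rewrite mem_rcons inE => /predU1P[->|]; first by rewrite T0 lexx.
  by move=> /(path_rcons_bounds pts)/andP[-> /ltW].
have msam : measurable_fun [set: Omega] (fun w => sampled ts (L ^~ w) : PS).
  by apply: measurable_sampled => t /range_ts; exact: mL.
have [mu muE] := bridge_law_measure nu pts.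
pose G : set (set PS) := [set A | exists (x : R -> R) (B : set RR),
  measurable B /\ A = box x ts `&` [set p | B (p T)]].
have mG : G `<=` measurable.
  move=> _ [x [B [mB ->]]]; apply: measurableI; first exact: measurable_box.
  by rewrite -[X in measurable X]setTI; exact: (measurable_coordinate T).
have [m1 m1E] : exists m1 : {measure set PS -> \bar R},
    m1 = pushforward P (fun w => sampled ts (L ^~ w) : PS)
      :> (set PS -> \bar R).
  pose m0 := (pushforward P (fun w => sampled ts (L ^~ w) : PS) :
    {measure set PS -> \bar R}).
  by exists (m0 msam).
have GE (A' : set PS) : G A' -> m1 A' = mu A'.
  move=> GA; have mA' := mG _ GA; case: GA => x [B [mB A'E]].
  rewrite muE// A'E bridge_law_box//.
  have [|||_ /(_ B mB) <-] := HL [seq (t, x t) | t <- ts].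
  - by case: (ts) ts0.
  - rewrite -map_comp map_id_in//.
    by move: pts; rewrite rcons_path => /andP[].
  - by apply/allP => _ /mapP[t tts ->] /=;
      case/andP: (path_rcons_bounds pts tts).
  rewrite m1E /pushforward; congr (P _); apply/seteqP; split => w /=.
    move=> [bw Bw]; split.
      move=> _ /mapP[t tts ->] /=; move: (bw t tts).
      by rewrite /sampled mem_rcons inE tts orbT.
    by move: Bw; rewrite /sampled mem_rcons mem_head.
  move=> [bw Bw]; split.
    move=> t tts; rewrite /sampled mem_rcons inE tts orbT.
    by apply: (bw (t, x t)); apply/mapP; exists t.
  by rewrite /sampled mem_rcons mem_head.
have sGE (A' : set PS) : <<s G >> A' -> m1 A' = mu A'.
  apply: (g_sigma_algebra_measure_unique G mG
    (fun n => box (fun=> n%:R) ts `&` [set p | [set: R] (p T)])) => //.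
  - by move=> n; exists (fun=> n%:R), setT; split.
  - apply/seteqP; split => // p _.
    have [n np] := box_cover ts p.
    by exists n.
  - move=> _ _ [x [B [mB ->]]] [y [C [mC ->]]].
    exists (fun t => Num.min (x t) (y t)), (B `&` C); split.
      exact: measurableI.
    apply/seteqP; split => p /=.
      move=> [[px pB] [py pC]]; split => // t tts.
      by rewrite le_min px// py.
    move=> [pxy [pB pC]]; split; split => // t /pxy; rewrite le_min.
      by case/andP.
    by case/andP.
  - move=> n; rewrite m1E; apply: (@le_lt_trans _ _ 1); last by rewrite ltry.
    apply: probability_le1; rewrite -[X in measurable X]setTI.
    by apply: msam => //; apply: mG; exists (fun=> n%:R), setT; split.
(* [G] only controls the observed coordinates: an event is first replaced by its
   preimage by [sampled], which depends on nothing else. *)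
pose sam : g_sigma_algebraType G -> PS := fun p => sampled ts p.
have msam' : measurable_fun setT sam.
  apply: measurable_fun_path => t _; rewrite /sam /sampled.
  have [tts|_] := boolP (t \in rcons ts T); last exact: measurable_cst.
  have sGbox (x : R -> R) (B : set RR) : measurable B ->
      <<s G >> (box x ts `&` [set p | B (p T)]).
    by move=> mB; apply: sub_sigma_algebra; exists x, B.
  move: tts; rewrite mem_rcons inE => /predU1P[->|tts].
    move=> _ B mB; rewrite setTI.
    rewrite (_ : _ @^-1` B = \bigcup_n
      (box (fun=> n%:R) ts `&` [set p | B (p T)])); last first.
      apply/seteqP; split => p /=; last by case=> ? _ [].
      by have [n np] := box_cover ts p; exists n.
    by apply: sigma_algebra_bigcup => n; exact: sGbox.
  apply: (measurability _ (RGenOInfty.measurableE R)) => // _ [_ [x ->] <-].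
  rewrite setTI.
  rewrite (_ : _ @^-1` _ = ~` \bigcup_n
      (box (fun r => if r == t then x else n%:R) ts `&`
        [set p | [set: R] (p T)])); last first.
    apply/seteqP; split => p /=; rewrite in_itv/= andbT.
      move=> xp [n _ [/(_ t tts)]]; rewrite eqxx => /le_lt_trans /(_ xp).
      by rewrite ltxx.
    rewrite ltNge => H; apply/negP => px; apply: H.
    have [n np] := box_cover ts p; exists n => //; split => // r rts.
    by case: eqP => [->//|_]; exact: np.
  apply: sigma_algebraC; apply: sigma_algebra_bigcup => n; exact: sGbox.
have sGA : <<s G >> (sam @^-1` A).
  by have := msam' measurableT _ mA; rewrite setTI.
have -> : P [set w | A (sampled ts (L ^~ w))] = m1 (sam @^-1` A).
  rewrite m1E /pushforward; congr (P _).
  by rewrite /sam; apply/seteqP; split => w /=; rewrite sampledK.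
rewrite sGE// muE//; last exact: (smallest_sub (@sigma_algebra_measurable _ PS) mG).
apply: eq_integral => z _; apply: bridge_int_congr => // q q' qp q'p qq' _.
congr (_%:E); rewrite !indicE.
rewrite (_ : (q \in sam @^-1` A) = (q' \in A))//.
have -> : q' = sampled ts q.
  apply/funext => t; rewrite /sampled; case: ifPn => [/qq'//|/q'p//].
by apply/idP/idP; rewrite !inE.
Qed.
End law.

(** * Integrals under equal laws *)

Section transport.
Local Open Scope ereal_scope.
Context {R : realType}.
Notation RR := (measurableTypeR R).

Lemma ge0_integral_mrestr d (S : measurableType d)
    (mu : {measure set S -> \bar R}) (E : set S) (mE : measurable E)
    (h : S -> \bar R) :
  measurable_fun setT h -> (forall x, 0 <= h x) ->
  \int[mrestr mu mE]_x h x = \int[mu]_(x in E) h x.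
Proof.
move=> mh h0.
rewrite (@ge0_negligible_integral _ _ _ _ setT (~` E)) => //.
- rewrite setTD setCK; apply: eq_measure_integral => A mA AE.
  by rewrite /= /mrestr setIidl.
- exact: measurableC.
- by rewrite /= /mrestr setICl measure0.
Qed.

(** Only the joint law of [X] and of the event [E] matters: the integral of
    [g (X w)] over [E] is that of [g] against the image by [X] of the measure
    restricted to [E]. *)
Lemma integral_same_law d (S : measurableType d) d' (S' : measurableType d')
    d'' (U : measurableType d'')
    (mu : {measure set S -> \bar R}) (mu' : {measure set S' -> \bar R})
    (E : set S) (E' : set S') (X : S -> U) (X' : S' -> U) (g : U -> \bar R) :
  measurable E -> measurable E' ->
  measurable_fun setT X -> measurable_fun setT X' ->
  measurable_fun setT g ->
  (forall B, measurable B -> mu (E `&` X @^-1` B) = mu' (E' `&` X' @^-1` B)) ->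
  \int[mu]_(w in E) g (X w) = \int[mu']_(w in E') g (X' w).
Proof.
move=> mE mE' mX mX' + same.
have ge0 (k : U -> \bar R) : measurable_fun setT k -> (forall x, 0 <= k x) ->
    \int[mu]_(w in E) k (X w) = \int[mu']_(w in E') k (X' w).
  move=> mk k0.
  rewrite -(ge0_integral_mrestr _ mE); [|exact: measurableT_comp|by []].
  rewrite -(ge0_integral_mrestr _ mE'); [|exact: measurableT_comp|by []].
  rewrite -(ge0_integral_pushforward mX (mrestr mu mE) measurableT (f := k))//.
  rewrite -(ge0_integral_pushforward mX' (mrestr mu' mE') measurableT (f := k))//.
  apply: eq_measure_integral => A mA _.
  have := same A mA; rewrite setIC [in RHS]setIC => sameA.
  exact: esym.
move=> mg; rewrite integralE [RHS]integralE.
have mp := measurable_funepos mg; have mn := measurable_funeneg mg.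
under [X in X - _ = _]eq_integral do rewrite (funepos_comp g X).
under [X in _ - X = _]eq_integral do rewrite (funeneg_comp g X).
under [X in _ = X - _]eq_integral do rewrite (funepos_comp g X').
under [X in _ = _ - X]eq_integral do rewrite (funeneg_comp g X').
by rewrite !ge0.
Qed.

Lemma measure_eq_off_null d (S : measurableType d)
    (mu : {measure set S -> \bar R}) (N X Y : set S) :
  measurable N -> measurable X -> measurable Y -> mu N = 0 ->
  (forall w, ~ N w -> X w <-> Y w) -> mu X = mu Y.
Proof.
move=> mN mX mY N0 XY.
have le (U V : set S) : measurable U -> measurable V ->
    (forall w, ~ N w -> U w -> V w) -> mu U <= mu V.
  move=> mU mV UV; rewrite -[leRHS]adde0 -N0.
  apply: le_trans (measureU2 _ mV mN).
  apply: le_measure; rewrite ?inE//; first exact: measurableU.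
  by move=> w Uw; have [Nw|Nw] := pselect (N w); [right|left; exact: UV].
by apply/eqP; rewrite eq_le !le// => w /XY[].
Qed.

End transport.

Section squash.
Local Open Scope ereal_scope.
Context {R : realType} {d} {Omega : measurableType d} (P : probability Omega R).
Notation RR := (measurableTypeR R).

(** A bounded continuous function that only vanishes at the origin, to test
    convergence in probability by dominated convergence. *)
Definition squash (x : R) : R := (`|x| / (1 + `|x|))%R.

Lemma squash_den (x : R) : (1 + `|x| != 0)%R.
Proof. by rewrite gt_eqF// ltr_wpDr. Qed.

Lemma continuous_squash : continuous squash.
Proof.
move=> x; apply: cvgM; first exact: norm_continuous.
apply: cvgV; first exact: squash_den.
by apply: cvgD; [exact: cvg_cst|exact: norm_continuous].
Qed.

Lemma squash_ge0 (x : R) : (0 <= squash x)%R.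
Proof. by rewrite divr_ge0// addr_ge0. Qed.

Lemma squash_le1 (x : R) : (squash x <= 1)%R.
Proof. by rewrite ler_pdivrMr ?mul1r ?lerDr// ltr_wpDr. Qed.

Lemma squash_eq0 (x : R) : (squash x == 0)%R = (x == 0)%R.
Proof. by rewrite mulf_eq0 invr_eq0 (negbTE (squash_den x)) orbF normr_eq0. Qed.

Lemma measurable_squash : measurable_fun [set: RR] (squash : RR -> RR).
Proof. by apply: continuous_measurable_fun; exact: continuous_squash. Qed.

Lemma cvg_integral_squash (Y : nat -> Omega -> R) (Z : Omega -> R) :
  (forall n, measurable_fun setT (Y n : Omega -> RR)) ->
  measurable_fun setT (Z : Omega -> RR) ->
  (forall w, Y n w @[n --> \oo] --> Z w) ->
  \int[P]_w (squash (Y n w))%:E @[n --> \oo] --> \int[P]_w (squash (Z w))%:E.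
Proof.
move=> mY mZ YZ.
have msq := measurable_squash.
have [] // := @dominated_convergence _ _ _ P setT measurableT
  (fun n w => (squash (Y n w))%:E) (fun w => (squash (Z w))%:E)
  (EFin \o cst 1%R).
- by move=> n; apply/measurable_EFinP; exact: (measurableT_comp msq (mY n)).
- by apply/measurable_EFinP; exact: (measurableT_comp msq mZ).
- apply: aeW => w _; apply: cvg_EFin; first exact: nearW.
  by apply: continuous_cvg; [exact: continuous_squash|exact: YZ].
- exact: finite_measure_integrable_cst.
- by apply: aeW => w n _; rewrite /= lee_fin ger0_norm ?squash_ge0// squash_le1.
Qed.

End squash.

(** * Reflection of a bridge over an interval *)

Section observation_times.
Context {R : realType} (T : R).

Lemma times_before (l : seq R) (s : R) : (0 <= s)%R ->
  exists ts, [/\ path <%R 0%R ts, last 0%R ts = s &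
    forall t, t \in l -> (0 < t <= s)%R -> t \in ts].
Proof.
rewrite le_eqVlt => /predU1P[<-|s0].
  by exists [::]; split => // t _; lra.
pose l' := sort <=%R (undup [seq t <- l | 0 < t < s]%R).
have l'E t : (t \in l') = (t \in l) && (0 < t < s)%R.
  by rewrite mem_sort mem_undup mem_filter andbC.
exists (rcons l' s); split; last 2 first.
- by rewrite last_rcons.
- move=> t tl /andP[t0]; rewrite mem_rcons inE l'E tl t0/= le_eqVlt.
  by case/orP => ->; rewrite ?orbT.
rewrite rcons_path (path_sortedE lt_trans); apply/andP; split.
  apply/andP; split; first by apply/allP => t; rewrite l'E => /and3P[].
  by rewrite lt_sorted_uniq_le sort_le_sorted sort_uniq undup_uniq.
have := mem_last 0%R l'; rewrite inE l'E => /predU1P[->//|].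
by case/and3P.
Qed.

Lemma times_after (l : seq R) (u : R) : (u <= T)%R ->
  exists ts, [/\ head T ts = u,
    (forall m, m < u -> path <%R m (rcons ts T))%R &
    forall t, t \in l -> (u <= t < T)%R -> t \in ts].
Proof.
rewrite le_eqVlt => /predU1P[->|uT].
  by exists [::]; split => [//|m /= ->//|t _]; lra.
pose l' := sort <=%R (undup [seq t <- l | u < t < T]%R).
have l'E t : (t \in l') = (t \in l) && (u < t < T)%R.
  by rewrite mem_sort mem_undup mem_filter andbC.
exists (u :: l'); split => //.
- move=> m mu /=; rewrite mu/= rcons_path (path_sortedE lt_trans).
  apply/andP; split.
    apply/andP; split; first by apply/allP => t; rewrite l'E => /and3P[].
    by rewrite lt_sorted_uniq_le sort_le_sorted sort_uniq undup_uniq.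
  have := mem_last u l'; rewrite inE l'E => /predU1P[->//|].
  by case/and3P.
- move=> t tl /andP[+ tT]; rewrite inE l'E tl tT/= andbT le_eqVlt eq_sym.
  by case/orP => ->; rewrite ?orbT.
Qed.

(** The times at which a bridge is observed when its values strictly between
    [s] and [u] are hidden. *)
Definition outside (s u : R) : set R :=
  [set r | (0 <= r <= T)%R /\ ((r <= s)%R \/ (u <= r)%R)].

End observation_times.

Section reflection.
Local Open Scope ereal_scope.
Context {R : realType} (f : R -> R -> \bar R) (T : R).
Context {d} {Omega : measurableType d} (P : probability Omega R)
  (nu : probability (measurableTypeR R) R) (L : R -> Omega -> R).
Notation PS := (path_space R).
Notation RR := (measurableTypeR R).
Hypothesis mf : forall t : R, (0 < t <= T)%R ->
  measurable_fun [set: RR] (f t).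
Hypothesis f0 : forall t x : R, (0 < t <= T)%R -> 0 <= f t x.
Hypothesis cL : cadlag_process `[0%R, T] L.
Hypothesis HL : forall l : seq (R * R),
     l != [::] -> path <%R 0%R (map fst l) -> all (fun p => p.1 < T)%R l ->
     is_cond_prob P nu [set w | forall p, p \in l -> (L p.1 w <= p.2)%R]
       (L T) (bridge_cdf f T 0%R 0%R l).
Hypothesis T0 : (0 < T)%R.

Lemma measurable_L t : (0 <= t <= T)%R -> measurable_fun setT (L t : Omega -> RR).
Proof. by move=> ht; apply: (cL.1 t); rewrite /= in_itv/=. Qed.

Lemma sampled_reflection (s m m' u : R) (ts1 ts2 : seq R) (A A' : set PS) :
  last 0%R ts1 = s -> head T ts2 = u ->
  path <%R 0%R (rcons (ts1 ++ m :: ts2) T) ->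
  path <%R 0%R (rcons (ts1 ++ m' :: ts2) T) ->
  (m - s = u - m')%R -> measurable A -> measurable A' ->
  (forall p q : R -> R, (forall r, (r <= s \/ u <= r)%R -> p r = q r) ->
     (p m - p s = q u - q m')%R -> A p <-> A' q) ->
  P [set w | A (sampled T (ts1 ++ m :: ts2) (L ^~ w))] =
  P [set w | A' (sampled T (ts1 ++ m' :: ts2) (L ^~ w))].
Proof.
move=> ls hu pm pm' mm mA mA' AA'.
have mL t : (0 < t <= T)%R -> measurable_fun setT (L t : Omega -> RR).
  by move=> /andP[/ltW t0 tT]; apply: measurable_L; rewrite t0.
rewrite (sampled_law mf f0 (nu := nu) _ pm mL HL mA); last by case: (ts1).
rewrite (sampled_law mf f0 (nu := nu) _ pm' mL HL mA'); last by case: (ts1).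
apply: eq_integral => z _.
refine (@bridge_int_swap _ f T mf f0 (fun q => (\1_A q)%:E)
  (fun q => (\1_A' q)%:E) _ _ _ _ _ _ _ _ _ (lexx 0%R) ls hu pm pm' mm
  _ _ _ _ _).
- exact: measurable_indicE.
- by move=> q; exact: indicE_ge0.
- exact: measurable_indicE.
- by move=> q; exact: indicE_ge0.
- move=> p q pq pqm; rewrite !indicE; congr ((nat_of_bool _)%:R%:E).
  have [AA'1 AA'2] := AA' p q pq pqm.
  by apply/idP/idP; rewrite !inE.
Qed.

(** Reflection over [(0, 2 h)].  The densities start from the position [0], so
    that the first increment is [L h] rather than [L h - L 0]. *)
Lemma law_short_increment (h : R) (B : set RR) : (0 < h)%R -> (2 * h < T)%R ->
  measurable B -> P (L h @^-1` B) = P [set w | B (L (2 * h) w - L h w)%R].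
Proof.
move=> h0 hT mB.
have pts : path <%R 0%R (rcons ([::] ++ h :: [:: 2 * h]) T)%R.
  by rewrite /= h0 hT andbT/= andbT; lra.
have N0 (t : R) : (0 < t)%R -> 0%R \notin rcons [:: t; (2 * t)%R] T.
  move=> t0; rewrite !inE !negb_or; apply/and3P; split => //; apply/eqP; lra.
have := @sampled_reflection 0%R h h (2 * h)%R [::] [:: (2 * h)%R]
  [set p | B (p h - p 0)%R] [set p | B (p (2 * h) - p h)%R] erefl erefl pts pts.
have -> : [set w | [set p : PS | B (p h - p 0)%R]
    (sampled T ([::] ++ h :: [:: (2 * h)%R]) (L ^~ w))] = L h @^-1` B.
  apply/seteqP; split => w /=; rewrite /sampled (negbTE (N0 h h0)) subr0;
    by rewrite !inE eqxx.
have -> : [set w | [set p : PS | B (p (2 * h) - p h)%R]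
    (sampled T ([::] ++ h :: [:: (2 * h)%R]) (L ^~ w))] =
    [set w | B (L (2 * h) w - L h w)%R].
  by apply/seteqP; split => w /=; rewrite /sampled !inE !eqxx ?orbT.
apply; first lra.
- exact: measurable_increment_path.
- exact: measurable_increment_path.
- by move=> p q _ /= ->.
Qed.

(** The definition of a bridge leaves [L 0] free.  But [L h] has the law of
    [L (2 h) - L h], and the latter tends to [0] with [h] since the paths are
    right-continuous at [0]. *)
Lemma bridge_starts_at_0 : P [set w | L 0%R w != 0%R] = 0.
Proof.
pose h n : R := (T / 3 * harmonic n)%R.
have h0 n : (0 < h n)%R by rewrite mulr_gt0 ?divr_gt0// /harmonic invr_gt0 ltr0n.
have hT n : (2 * h n < T)%R.
  have : (h n <= T / 3)%R.
    by rewrite ger_pMr ?divr_gt0// invf_le1// ler1n.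
  have := h0 n; lra.
have h_cvg : h n @[n --> \oo] --> 0%R.
  rewrite -[0%R](mulr0 (T / 3)%R); apply: cvgMr.
  exact: cvg_harmonic.
have L_cvg w (u : nat -> R) : (forall n, 0 < u n)%R ->
    u n @[n --> \oo] --> 0%R -> L (u n) w @[n --> \oo] --> L 0%R w.
  move=> u0 uc; have := (cL.2 w 0%R _).1; rewrite /= in_itv/= lexx (ltW T0).
  move=> /(_ isT); have H : exists2 s : R, `[0%R, T]%classic s & (0 < s)%R.
    by exists T => //; rewrite /= in_itv/= lexx (ltW T0).
  by move=> /(_ H) /cvg_at_rightP; apply; split.
have mL0 : measurable_fun setT (L 0%R : Omega -> RR).
  by apply: measurable_L; rewrite lexx ltW.
have mLh n : measurable_fun setT (L (h n) : Omega -> RR).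
  by apply: measurable_L; have := h0 n; have := hT n; lra.
have mL2h n : measurable_fun setT (L (2 * h n)%R : Omega -> RR).
  by apply: measurable_L; have := h0 n; have := hT n; lra.
have c1 := cvg_integral_squash (P := P) mLh mL0 (fun w => L_cvg w h h0 h_cvg).
have mD n : measurable_fun setT ((fun w => L (2 * h n) w - L (h n) w)%R : Omega -> RR).
  exact: (measurable_funB (mL2h n) (mLh n)).
have c2 : \int[P]_w (squash (L (h n) w))%:E @[n --> \oo] -->
    \int[P]_w (squash 0%R)%:E.
  have same n : \int[P]_w (squash (L (h n) w))%:E =
      \int[P]_w (squash (L (2 * h n) w - L (h n) w)%R)%:E.
    apply: (@integral_same_law _ _ _ _ _ _ RR P P setT setT (L (h n))
      (fun w => L (2 * h n) w - L (h n) w)%R (fun x => (squash x)%:E)) => //.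
    - by apply/measurable_EFinP; exact: measurable_squash.
    - by move=> B mB; rewrite !setTI; exact: (law_short_increment (h0 n) (hT n)).
  under eq_fun do rewrite same.
  apply: (cvg_integral_squash (P := P) (Z := fun=> 0%R)) => // w.
  rewrite -[0%R](subrr (L 0%R w)); apply: cvgB; apply: L_cvg => //.
    by move=> n; rewrite mulr_gt0.
  by rewrite -[0%R](mulr0 2%R); apply: cvgMr.
have /ae_eq_integral_abs : \int[P]_w `|(squash (L 0%R w))%:E| = 0.
  under eq_integral do rewrite gee0_abs ?lee_fin ?squash_ge0//.
  rewrite (cvg_unique _ c1 c2)//.
  by apply: integral0_eq => w _; rewrite /squash normr0 mul0r.
case=> // [|N [mN N0 subN]].
  by apply/measurable_EFinP; exact: (measurableT_comp measurable_squash mL0).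
apply: subset_measure0 N0 => //.
  rewrite (_ : [set w | _] = L 0%R @^-1` (~` [set 0%R])).
    by rewrite -[X in measurable X]setTI; apply: mL0 => //; apply: measurableC; exact: measurable_set1.
  by apply/seteqP; split => w /= /eqP.
move=> w /= Lw; apply: subN => /= /(_ I) [] /eqP.
by rewrite squash_eq0 (negbTE Lw).
Qed.

(** The observation times are sorted around [s] and [u], with [s + h] or
    [u - h] inserted in between.  They must be positive, which is why the value
    at the time [0] has to be known to vanish. *)
Lemma cylinder_reflection (s u h : R) (ts : seq R) (B : R -> set RR)
    (C : set RR) :
  (0 <= s)%R -> (u <= T)%R -> (0 < h < u - s)%R ->
  (forall t, t \in ts -> outside T s u t) -> (forall t, measurable (B t)) ->
  measurable C ->
  P ([set w | cylinder ts B (L ^~ w)] `&`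
     [set w | C (L (s + h) w - L s w)%R]) =
  P ([set w | cylinder ts B (L ^~ w)] `&`
     [set w | C (L u w - L (u - h) w)%R]).
Proof.
move=> s0 uT hsu tsJ mB mC.
have [ts1 [pts1 last1 mem1]] := times_before (s :: ts) s0.
have [ts2 [head2 pts2 mem2]] := times_after (u :: ts) uT.
have pm m : (s < m < u)%R -> path <%R 0%R (rcons (ts1 ++ m :: ts2) T).
  move=> /andP[sm mu]; rewrite rcons_cat cat_path pts1 last1 rcons_cons /= sm.
  exact: pts2.
pose A t t' : set PS := cylinder ts B `&` [set p | C (p t - p t')%R].
have mA t t' : measurable (A t t').
  apply: measurableI; last exact: measurable_increment_path.
  by apply: measurable_cylinder.
have mLt t : (0 <= t <= T)%R -> measurable_fun setT (L t : Omega -> RR).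
  exact: measurable_L.
have mcyl : measurable [set w | cylinder ts B (L ^~ w)].
  rewrite (_ : [set w | _] = \bigcap_(t in [set` ts]) (L t @^-1` B t)).
    apply: fin_bigcap_measurable => // t /= /tsJ[tT _].
    by rewrite -[X in measurable X]setTI; exact: mLt.
  by apply/seteqP; split.
have mdiff t t' : (0 <= t <= T)%R -> (0 <= t' <= T)%R ->
    measurable [set w | C (L t w - L t' w)%R].
  move=> ht ht'; rewrite -[X in measurable X]setTI.
  by apply: (measurable_funB (mLt _ ht) (mLt _ ht')).
have samE m t t' w : (s < m < u)%R -> L 0%R w = 0%R ->
    t \in [:: s; m; u] -> t' \in [:: s; m; u] ->
    (cylinder ts B (L ^~ w) /\ C (L t w - L t' w)%R) <->
    A t t' (sampled T (ts1 ++ m :: ts2) (L ^~ w)).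
  move=> smu L0 tsmu tsmu'.
  have sE r : (r \in s :: u :: ts) \/ r = m ->
      sampled T (ts1 ++ m :: ts2) (L ^~ w) r = L r w.
    move=> Hr; rewrite /sampled; case: ifPn => //.
    rewrite mem_rcons inE mem_cat inE !negb_or => /and4P[/eqP rT r1 /eqP rm r2].
    have {Hr} [rs|//] := Hr.
    have rJ : outside T s u r.
      move: rs; rewrite !inE => /or3P[/eqP->|/eqP->|/tsJ//].
        by split; [lra|left].
      by split; [lra|right].
    have [r0 rsu] := rJ; have [->|r0'] := eqVneq r 0%R; first by rewrite L0.
    exfalso; case: rsu => rsu.
      move/negP: r1; apply; apply: mem1.
        move: rs; rewrite !inE => /or3P[->//|/eqP ru|->]; last by rewrite orbT.
        by exfalso; lra.
      by rewrite lt_def r0' rsu andbT/=; case/andP: r0.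
    move/negP: r2; apply; apply: mem2.
      move: rs; rewrite !inE => /or3P[/eqP ru|->//|->]; last by rewrite orbT.
      by exfalso; lra.
    by rewrite rsu lt_neqAle; case/andP: r0 => _ ->; rewrite andbT; apply/eqP.
  have sE' r : r \in [:: s; m; u] ->
      sampled T (ts1 ++ m :: ts2) (L ^~ w) r = L r w.
    rewrite !inE => /or3P[Hr|/eqP->|Hr]; apply: sE; [left|by right|left].
      by rewrite !inE Hr.
    by rewrite !inE Hr orbT.
  rewrite /A /= !sE'//; split => -[cw Cw]; split => // r rts.
    by rewrite sE; [exact: cw|left; rewrite !inE rts !orbT].
  by rewrite -sE; [exact: cw|left; rewrite !inE rts !orbT].
have msam m t t' : (s < m < u)%R ->
    measurable [set w | A t t' (sampled T (ts1 ++ m :: ts2) (L ^~ w))].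
  move=> smu; rewrite -[X in measurable X]setTI.
  apply: (measurable_sampled (T := T) (L := L) (ts := ts1 ++ m :: ts2)) => //.
  move=> r rts; apply: mLt; move: rts; rewrite mem_rcons inE.
  case/predU1P => [->|/(path_rcons_bounds (pm _ smu))/andP[r0 rT]].
    by rewrite lexx ltW.
  by rewrite !ltW.
have mN : measurable [set w | L 0%R w != 0%R].
  rewrite (_ : [set w | _] = L 0%R @^-1` (~` [set 0%R])).
    rewrite -[X in measurable X]setTI; apply: mLt => //.
      by rewrite lexx ltW.
    by apply: measurableC; exact: measurable_set1.
  by apply/seteqP; split => w /= /eqP.
have shE m t t' : (s < m < u)%R ->
    t \in [:: s; m; u] -> t' \in [:: s; m; u] ->
    P ([set w | cylinder ts B (L ^~ w)] `&` [set w | C (L t w - L t' w)%R]) =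
    P [set w | A t t' (sampled T (ts1 ++ m :: ts2) (L ^~ w))].
  move=> smu tsmu tsmu'; apply: (measure_eq_off_null mN) => //.
  - have bd r : r \in [:: s; m; u] -> (0 <= r <= T)%R.
      by rewrite !inE => /or3P[] /eqP ->; lra.
    by apply: measurableI => //; apply: mdiff; exact: bd.
  - exact: msam.
  - exact: bridge_starts_at_0.
  - move=> w /negP; rewrite negbK => /eqP L0.
    exact: samE.
rewrite (shE (s + h)%R); [|lra|by rewrite !inE eqxx orbT|by rewrite !inE eqxx].
rewrite (shE (u - h)%R); [|lra|by rewrite !inE eqxx !orbT|by rewrite !inE eqxx orbT].
apply: (sampled_reflection last1 head2) => //.
- by apply: pm; lra.
- by apply: pm; lra.
- lra.
- move=> p q pq pqE; rewrite /A /= pqE.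
  by split => -[cp Cp]; split => // t tts; have [_ tJ] := tsJ t tts;
    [rewrite -pq|rewrite pq]; rewrite //; exact: cp.
Qed.

End reflection.

Section bridge_reflection.
Local Open Scope ereal_scope.
Context {R : realType} (T : R) {d} {Omega : measurableType d}
  (P : probability Omega R) (nu : probability (measurableTypeR R) R)
  (L : R -> Omega -> R).
Notation RR := (measurableTypeR R).
Hypothesis bL : levy_random_bridge P T nu L.

Lemma measurable_bridge t : (0 <= t <= T)%R ->
  measurable_fun setT (L t : Omega -> RR).
Proof. by case: bL => _ cL _ ht; exact: (measurable_L cL). Qed.

Lemma measurable_outside_event (J : set R) (A : set (R -> R)) :
  (forall t, J t -> (0 <= t <= T)%R) -> <<s coordinate_sets J >> A ->
  measurable [set w | A (L ^~ w)].
Proof.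
move=> J0T mA.
have mX : measurable_fun setT
    ((fun w => L ^~ w) : Omega -> g_sigma_algebraType (coordinate_sets J)).
  by apply: measurable_fun_path => t /J0T; exact: measurable_bridge.
by have := mX measurableT _ mA; rewrite setTI.
Qed.

Lemma measurable_bridge_increment t t' : (0 <= t <= T)%R -> (0 <= t' <= T)%R ->
  measurable_fun setT ((fun w => L t w - L t' w)%R : Omega -> RR).
Proof.
by move=> ht ht'; exact: measurable_funB (measurable_bridge ht) (measurable_bridge ht').
Qed.

(** Given the bridge outside [(s, u)], the increment over the first [h] units of
    time has the law of the increment over the last [h] units of time.  Finitely
    many observation times are enough, because the corresponding cylinders
    generate the events outside [(s, u)]. *)
Lemma bridge_reflection (s u h : R) (A : set (R -> R)) (C : set RR) :
  (0 <= s)%R -> (u <= T)%R -> (0 <= h <= u - s)%R ->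
  <<s coordinate_sets (outside T s u) >> A -> measurable C ->
  P ([set w | A (L ^~ w)] `&`
     [set w | C (L (s + h) w - L s w)%R]) =
  P ([set w | A (L ^~ w)] `&`
     [set w | C (L u w - L (u - h) w)%R]).
Proof.
move=> s0 uT /andP[h0 hsu] mA mC.
have [->|hN0] := eqVneq h 0%R.
  by congr (P (_ `&` _)); apply/seteqP; split => w /=; rewrite addr0 subr0 !subrr.
have [hE|hNsu] := eqVneq h (u - s)%R.
  have -> : (s + h = u)%R by lra.
  by have -> : (u - h = s)%R by lra.
have {hN0 hNsu}{}hsu : (0 < h < u - s)%R by rewrite !lt_neqAle eq_sym hN0 h0 hNsu hsu.
pose PJ := g_sigma_algebraType (coordinate_sets (outside T s u)).
have mX : measurable_fun setT ((fun w => L ^~ w) : Omega -> PJ).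
  by apply: measurable_fun_path => t [ht _]; exact: measurable_bridge.
have mD t t' : (0 <= t <= T)%R -> (0 <= t' <= T)%R ->
    measurable [set w | C (L t w - L t' w)%R].
  move=> ht ht'; rewrite -[X in measurable X]setTI.
  exact: (measurable_bridge_increment ht ht').
have mD1 : measurable [set w | C (L (s + h) w - L s w)%R] by apply: mD; lra.
have mD2 : measurable [set w | C (L u w - L (u - h) w)%R] by apply: mD; lra.
have restricted E : measurable E -> exists m : {measure set PJ -> \bar R},
    forall B, m B = P ([set w | B (L ^~ w)] `&` E).
  move=> mE; pose m := (pushforward (mrestr P mE) ((fun w => L ^~ w) : Omega -> PJ) :
    {measure set PJ -> \bar R}).
  by exists (m mX).
have [m1 m1E] := restricted _ mD1; have [m2 m2E] := restricted _ mD2.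
rewrite -m1E -m2E.
pose G : set (set PJ) := [set A | exists (ts : seq R) (B : R -> set RR),
  [/\ forall t, t \in ts -> outside T s u t, forall t, measurable (B t) &
      A = cylinder ts B]].
have GE : coordinate_sets (outside T s u) `<=` G.
  move=> _ [t [B [Jt mB ->]]]; exists [:: t], (fun=> B); split => //.
    by move=> r; rewrite inE => /eqP ->.
  apply/seteqP; split => p /=; first by move=> Bp r; rewrite inE => /eqP ->.
  by apply; rewrite inE.
have mG : G `<=` (measurable : set (set PJ)).
  by move=> _ [ts [B [tsJ mB ->]]]; exact: measurable_cylinder.
apply: (g_sigma_algebra_measure_unique G mG (fun=> setT)).
- move=> _; exists [::], (fun=> setT); split => //.
  by apply/seteqP; split.
- by apply/seteqP; split => // p _; exists 0%N.
- move=> _ _ [ts [B [tsJ mB ->]]] [ts' [B' [tsJ' mB' ->]]].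
  exists (ts ++ ts'), (fun t => (if t \in ts then B t else setT) `&`
    (if t \in ts' then B' t else setT)); split.
  + by move=> t; rewrite mem_cat => /orP[/tsJ|/tsJ'].
  + by move=> t; apply: measurableI; case: ifP.
  + apply/seteqP; split => p /=.
      by move=> [pB pB'] t _; split; case: ifPn => //; [exact: pB|exact: pB'].
    move=> H; split => t tts; have := H t; rewrite mem_cat tts ?orbT => /(_ isT);
      by case.
- move=> _ [ts [B [tsJ mB ->]]]; rewrite m1E m2E.
  have [T0 cL bL'] := bL.
  have [d1 [S1 [Q [X [f [_ [df _] _ _ HL]]]]]] := bL'.
  have mf t (ht : (0 < t <= T)%R) : measurable_fun setT (f t : RR -> \bar R) by have [] := df t ht.
  have f0 t x (ht : (0 < t <= T)%R) : 0 <= f t x by have [] := df t ht.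
  exact: (cylinder_reflection mf f0 cL HL T0 s0 uT hsu tsJ mB mC).
- move=> _; rewrite m1E setTI; apply: (@le_lt_trans _ _ 1); last by rewrite ltry.
  exact: probability_le1.
- exact: (@sub_sigma_algebra2 _ _ _ _ GE).
Qed.

End bridge_reflection.

(** * Measurable additive functions are linear *)

Section additive.
Context {R : realType} (l : R).
Notation RR := (measurableTypeR R).
Hypothesis l0 : 0 < l.

Lemma additive_natmul (g : R -> R) (k : nat) (x : R) :
  (forall x y, 0 <= x -> 0 <= y -> x + y <= l -> g (x + y) = g x + g y) ->
  0 <= x -> k%:R * x <= l -> g (k%:R * x) = k%:R * g x.
Proof.
move=> gD x0; elim: k => [|k IH] kx.
  have := gD 0 0; rewrite !mul0r addr0 lexx => /(_ isT isT (ltW l0)).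
  by move=> /eqP; rewrite -subr_eq subrr eq_sym => /eqP.
have kx' : k%:R * x + x <= l by move: kx; rewrite -natr1 mulrDl mul1r.
have k0 : 0 <= k%:R * x by rewrite mulr_ge0.
rewrite -natr1 !mulrDl !mul1r gD// IH//; lra.
Qed.

Definition bounded_part (g : R -> R) (n : nat) : set RR :=
  [set x : RR | `|g x| <= n%:R] `&` `[0, l]%classic.

Lemma measurable_bounded_part (g : RR -> RR) n : measurable_fun setT g ->
  measurable (bounded_part g n).
Proof.
move=> mg; apply: measurableI; last exact: measurable_itv.
rewrite (_ : [set x | _] = g @^-1` `[- n%:R, n%:R]%classic); last first.
  by apply/seteqP; split => x /=; rewrite in_itv/= ler_norml.
by rewrite -[X in measurable X]setTI; apply: mg => //; exact: measurable_itv.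
Qed.

Lemma exists_large_bounded_part (g : RR -> RR) : measurable_fun setT g ->
  exists n : nat, ((3 / 4 * l)%:E < lebesgue_measure (bounded_part g n))%E.
Proof.
move=> mg; pose E n := bounded_part g n.
have mE n : measurable (E n) by exact: measurable_bounded_part.
have UE : \bigcup_n E n = `[0, l]%classic.
  apply/seteqP; split => x; first by case=> n _ [].
  move=> xl; exists (Num.truncn `|g x|).+1 => //; split => //=.
  by apply: ltW; exact: truncnS_gt.
have ndE : nondecreasing_seq E.
  move=> i j ij; apply/subsetPset => x [/= gx xl]; split => //=.
  by apply: le_trans gx _; rewrite ler_nat.
have := nondecreasing_cvg_mu (mu := @lebesgue_measure R) mE _ ndE.
have lE : lebesgue_measure (`[0, l]%classic : set RR) = l%:E.
  by rewrite lebesgue_measure_itv/= lte_fin l0 -EFinD subr0.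
rewrite UE => /(_ (measurable_itv _)); rewrite [X in _ --> X]lE => H.
apply: contrapT => /forallNP small.
have : (l%:E <= (3 / 4 * l)%:E)%E.
  rewrite -(cvg_lim _ H)//; apply: lime_le; first by apply/cvg_ex; exists l%:E.
  by apply: nearW => n /=; rewrite leNgt; apply/negP; exact: small.
by rewrite lee_fin; move: l0; clear; lra.
Qed.

(** After subtraction of a linear function, [g] is additive and vanishes at [l].
    It is bounded by some [M] on a set of measure more than [3 l / 4].  For
    [h < l / 2], this set meets its mirror image about [(l + h) / 2], at some [x];
    since [g l = 0], additivity gives [g h = g x + g (l + h - x)], bounded by
    [2 M].  As [g] also vanishes at [l / (2 k)], its value at any point is its
    value at some [r < l / (2 k)], that is [g (k r) / k], bounded by [2 M / k] for
    every [k]. *)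
Lemma additive_measurable_linear (phi : RR -> RR) : measurable_fun setT phi ->
  (forall x y, 0 <= x -> 0 <= y -> x + y <= l ->
     phi (x + y) = phi x + phi y) ->
  forall x, 0 <= x <= l -> phi x = x / l * phi l.
Proof.
move=> mphi phiD.
pose g : RR -> RR := fun x => phi x - x / l * phi l.
have lN0 : l != 0 by rewrite gt_eqF.
have gD x y : 0 <= x -> 0 <= y -> x + y <= l -> g (x + y) = g x + g y.
  by move=> x0 y0 xyl; rewrite /g phiD//; ring.
have gl : g l = 0 by rewrite /g divff// mul1r subrr.
have mg : measurable_fun setT g.
  apply: measurable_funB => //; apply: measurable_funM => //.
  exact: measurable_funM.
suff g_eq0 x : 0 <= x < l -> g x = 0.
  move=> x /andP[x0]; rewrite le_eqVlt => /predU1P[->|xl].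
    by rewrite divff// mul1r.
  by have := g_eq0 x; rewrite x0 xl => /(_ isT) /eqP; rewrite subr_eq0 => /eqP.
have [n large] := exists_large_bounded_part mg.
pose E := bounded_part g n.
have mE : measurable E by exact: measurable_bounded_part.
move=> /andP[x0 xl].
move: x x0 xl.
have near0 h : 0 <= h < l / 2 -> `|g h| <= 2 * n%:R.
  move=> hl; apply: contrapT => gh.
  pose F : set RR := [set x | E (l + h - x)].
  have mF : measurable F.
    have mr : measurable_fun setT ((fun x => l + h - x) : RR -> RR).
      exact: measurable_funB.
    by rewrite -[F]setTI; exact: mr.
  have FE : lebesgue_measure F = lebesgue_measure E.
    have indE (G : set RR) : measurable G ->
        (\int[lebesgue_measure]_x (\1_G x)%:E)%E = @lebesgue_measure R G.
      by move=> mG; rewrite integral_indic// setIT.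
    rewrite -!indE// -(ge0_integral_reflection (l + h) (g := fun x => (\1_E x)%:E)).
    - by apply: eq_integral => x _; rewrite !indicE; congr ((nat_of_bool _)%:R%:E);
        apply/idP/idP; rewrite !inE.
    - by apply/measurable_EFinP; exact: measurable_indic.
    - by move=> x; rewrite lee_fin indicE.
  have EF0 : E `&` F = set0.
    apply/seteqP; split => // x [] [/= gx]; rewrite in_itv/= => xl [/= gy].
    rewrite in_itv/= => yl; apply: gh.
    have e1 : g x = g (x - h) + g h by rewrite -gD; [congr g; lra|lra..].
    have e2 : g l = g (x - h) + g (l + h - x).
      by rewrite -gD; [congr g; lra|lra..].
    have -> : g h = g x + g (l + h - x) by move: e1 e2; rewrite gl; lra.
    by rewrite (le_trans (ler_normD _ _))//; lra.
  have : (lebesgue_measure (E `|` F) <= (l + h)%:E)%E.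
    have -> : (l + h)%:E = lebesgue_measure (`[0, l + h]%classic : set RR).
      by rewrite lebesgue_measure_itv/= lte_fin ifT -?EFinD ?subr0//; lra.
    apply: le_measure; rewrite ?inE; [exact: measurableU|exact: measurable_itv|].
    by move=> x [] [_ /=]; rewrite !in_itv/=; lra.
  have -> : lebesgue_measure (E `|` F) =
      (lebesgue_measure E + lebesgue_measure E)%E.
    by rewrite -{2}FE; exact: measureU.
  rewrite leNgt => /negP; apply.
  apply: (@lt_le_trans _ _ ((3 / 4 * l)%:E + (3 / 4 * l)%:E)%E).
    by rewrite -EFinD lte_fin; lra.
  by apply: leeD; exact: ltW.
move=> x x0 xl.
have bound k : (0 < k)%N -> k%:R * `|g x| <= 2 * n%:R.
  move=> k0; have k0' : 0 < k%:R :> R by rewrite ltr0n.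
  pose y := l / (2 * k%:R); have y0 : 0 < y by rewrite divr_gt0// mulr_gt0.
  have yE : (2 * k)%:R * y = l.
    by rewrite /y natrM; field; rewrite gt_eqF.
  have gy : g y = 0.
    have := @additive_natmul g (2 * k) y gD (ltW y0); rewrite yE lexx gl.
    move=> /(_ isT) /esym/eqP; rewrite mulf_eq0 pnatr_eq0 muln_eq0/=.
    by rewrite (negbTE (lt0n_neq0 k0))/= => /eqP.
  pose j := Num.truncn (x / y).
  have /andP[jx xj] : j%:R <= x / y < j.+1%:R.
    by apply: truncn_itv; rewrite divr_ge0// ltW.
  have jx' : j%:R * y <= x by rewrite -ler_pdivlMr.
  have xj' : x < j%:R * y + y.
    by move: xj; rewrite ltr_pdivrMr// -natr1 mulrDl mul1r.
  have jy0 : 0 <= j%:R * y by rewrite mulr_ge0// ltW.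
  have -> : g x = g (x - j%:R * y).
    have {1}-> : x = j%:R * y + (x - j%:R * y) by lra.
    rewrite (gD (j%:R * y)); [|lra..].
    have jyl : j%:R * y <= l by lra.
    by rewrite (additive_natmul gD (ltW y0) jyl) gy mulr0 add0r.
  have r0 : 0 <= x - j%:R * y by lra.
  have ky : k%:R * y = l / 2.
    by rewrite /y; field; rewrite gt_eqF.
  have kr : k%:R * (x - j%:R * y) < l / 2.
    by rewrite -ky ltr_pM2l//; lra.
  rewrite -[X in X * _](@ger0_norm _ k%:R)// -normrM.
  rewrite -(additive_natmul gD r0); last lra.
  by apply: near0; rewrite kr andbT mulr_ge0.
apply/eqP; rewrite -normr_eq0 eq_le normr_ge0 andbT leNgt; apply/negP => gx.
pose k := (Num.truncn (2 * n%:R / `|g x|)).+1.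
have := bound k isT; rewrite -ler_pdivlMr// leNgt => /negP; apply.
exact: truncnS_gt.
Qed.

End additive.

(** * Joint measurability of right-continuous processes *)

Section cadlag.
Context {R : realType} (T : R) {d} {S : measurableType d} (X : R -> S -> R).
Notation RR := (measurableTypeR R).
Hypothesis T0 : 0 < T.
Hypothesis cX : cadlag_process `[0, T] X.

Definition clamp (t : R) : R := Num.max 0 (Num.min T t).

Lemma clamp_id t : 0 <= t <= T -> clamp t = t.
Proof. by move=> /andP[t0 tT]; rewrite /clamp min_r// max_r. Qed.

(** The grid point strictly to the right of [t] (and of [0]), cut off at [T]:
    approximation from the right is what right-continuity can use. *)
Definition grid (n : nat) (t : R) : R :=
  Num.min T ((Num.truncn (n.+1%:R * t)).+1%:R / n.+1%:R).

Lemma measurable_grid_process n :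
  measurable_fun setT (fun p : RR * S => X (grid n p.1) p.2 : RR).
Proof.
have mtr : measurable_fun setT ((fun t : RR => (Num.truncn (n.+1%:R * t))%:R) : RR -> RR).
  apply: nondecreasing_measurable => // x y xy.
  rewrite ler_nat; apply: le_truncn; exact: ler_wpM2l.
move=> _ B mB; rewrite setTI.
pose v (k : nat) : R := Num.min T (k.+1%:R / n.+1%:R).
rewrite (_ : _ @^-1` B = \bigcup_k
  (((fun t : RR => (Num.truncn (n.+1%:R * t))%:R : RR) @^-1` [set k%:R]) `*`
   (X (v k) @^-1` B))).
  apply: bigcup_measurable => k _; apply: measurableX.
    by rewrite -[X in measurable X]setTI; apply: mtr => //; exact: measurable_set1.
  rewrite -[X in measurable X]setTI; apply: (cX.1 (v k)) => //.
  by rewrite /= in_itv/= /v ge_min lexx/= andbT le_min (ltW T0)/= divr_ge0.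
apply/seteqP; split => -[t w] /=.
  by move=> Bt; exists (Num.truncn (n.+1%:R * t)).
by move=> [k _ [/= /eqP]]; rewrite eqr_nat /grid => /eqP ->.
Qed.

Lemma cvg_grid_process t w :
  X (grid n t) w @[n --> \oo] --> X (clamp t) w.
Proof.
have [Tt|tT] := leP T t.
  have -> : clamp t = T by rewrite /clamp min_l// max_r// ltW.
  rewrite (_ : (fun n => _) = (fun=> X T w)); first exact: cvg_cst.
  apply/funext => n; rewrite /grid min_l//.
  rewrite ler_pdivlMr// (le_trans _ (ltW (truncnS_gt _)))// mulrC.
  exact: ler_wpM2l.
pose c := Num.max 0 t.
have cE : clamp t = c by rewrite /clamp min_r// ltW.
have c0 : 0 <= c by rewrite /c le_max lexx.
have cT : c < T by rewrite /c gt_max T0.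
have lt_grid n : c < (Num.truncn (n.+1%:R * t)).+1%:R / n.+1%:R.
  rewrite ltr_pdivlMr// mulrC; have [t0|t0] := leP 0 t.
    by rewrite /c max_r//; exact: truncnS_gt.
  by rewrite /c max_l ?mulr0// ltW.
have grid_le n :
    (Num.truncn (n.+1%:R * t)).+1%:R / n.+1%:R <= c + n.+1%:R^-1.
  rewrite -natr1 mulrDl mul1r lerD2r ler_pdivrMr// mulrC.
  have [t0|t0] := leP 0 t.
    by rewrite /c max_r// truncn_le mulr_ge0.
  rewrite truncn_floor ifF; first by rewrite mulr_ge0.
  by apply/negbTE; rewrite -ltNge pmulr_llt0 ?ltr0n.
rewrite cE; have := (cX.2 w c _).1; rewrite /= in_itv/= c0 (ltW cT) => /(_ isT).
have H : exists2 s : R, `[0, T]%classic s & c < s.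
  by exists T => //; rewrite /= in_itv/= lexx ltW.
move=> /(_ H)/cvg_at_rightP; apply; split => [n|].
  by rewrite /grid lt_min cT lt_grid.
apply: (@squeeze_cvgr _ _ _ _ (fun=> c) (fun n => c + n.+1%:R^-1)).
- apply: nearW => n; rewrite /grid le_min (ltW cT) (ltW (lt_grid n))/=.
  by rewrite ge_min grid_le orbT.
- exact: cvg_cst.
- rewrite -[X in _ --> X]addr0; apply: cvgD; first exact: cvg_cst.
  exact: cvg_harmonic.
Qed.

Lemma measurable_cadlag_process :
  measurable_fun setT (fun p : RR * S => X (clamp p.1) p.2 : RR).
Proof.
refine (@measurable_fun_cvg _ (RR * S)%type R setT
  (fun n (p : RR * S) => X (grid n p.1) p.2) _ _ _).
  exact: measurable_grid_process.
by move=> [t w] _; exact: cvg_grid_process.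
Qed.

End cadlag.

(** * The harness property of an integrable bridge *)

Section bridge_consequences.
Local Open Scope ereal_scope.
Context {R : realType} (T : R) {d} {Omega : measurableType d}
  (P : probability Omega R) (nu : probability (measurableTypeR R) R)
  (L : R -> Omega -> R).
Notation RR := (measurableTypeR R).
Hypothesis bL : levy_random_bridge P T nu L.

Lemma coordinate_sets_subset (J K : set R) (A : set (R -> R)) : J `<=` K ->
  <<s coordinate_sets J >> A -> <<s coordinate_sets K >> A.
Proof.
move=> JK; apply: sub_sigma_algebra2 => _ [t [B [Jt mB ->]]].
by exists t, B; split => //; exact: JK.
Qed.

Section bridge_harness.
Variables (s t : R) (A : set (R -> R)).
Hypotheses (s0 : (0 <= s)%R) (st : (s < t)%R) (tT : (t <= T)%R).
Hypothesis mA : <<s coordinate_sets (outside T s t) >> A.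
Hypothesis intL : forall r, (0 <= r <= T)%R ->
  P.-integrable setT (fun w => (L r w - L 0%R w)%:E).

Let E := [set w | A (L ^~ w)].

Let mE : measurable E.
Proof. by apply: (measurable_outside_event bL _ mA) => r [+ _]. Qed.

Lemma integrable_increment r r' : (0 <= r <= T)%R -> (0 <= r' <= T)%R ->
  P.-integrable setT (fun w => (L r w - L r' w)%:E).
Proof.
move=> hr hr'.
rewrite (_ : (fun w => _) = (fun w => (L r w - L 0%R w)%:E - (L r' w - L 0%R w)%:E)).
  by apply: integrableB => //; exact: intL.
by apply/funext => w; rewrite -EFinB; congr EFin; ring.
Qed.

Let integrable_on_E r r' : (0 <= r <= T)%R -> (0 <= r' <= T)%R ->
  P.-integrable E (fun w => (L r w - L r' w)%:E).
Proof.
by move=> hr hr'; apply: integrableS (integrable_increment hr hr').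
Qed.

(** The expectation of the increment over [(s, s + h)] on [E]; the time is clamped
    because paths are right-continuous, and so jointly measurable, on [[0, T]]
    only. *)
Let phi (h : RR) : RR := fine (\int[P]_(w in E) (L (clamp T (s + h)) w - L s w)%:E).

Let measurable_phi : measurable_fun setT phi.
Proof.
have [T0 cL _] := bL.
pose F (q : RR * Omega) : \bar R :=
  (\1_E q.2 * (L (clamp T (s + q.1)) q.2 - L s q.2))%:E.
have mF : measurable_fun setT F.
  apply/measurable_EFinP; apply: measurable_funM.
    by apply: measurableT_comp measurable_snd; exact: measurable_indic.
  apply: measurable_funB.
    apply: (measurableT_comp (measurable_cadlag_process T0 cL)
      (g := fun q : RR * Omega => ((s + q.1)%R : RR, q.2))).
    apply: measurable_fun_pair; last exact: measurable_snd.
    by apply: measurable_funD => //; exact: measurable_fst.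
  have mLs : measurable_fun setT (L s : Omega -> RR).
    by apply: (measurable_bridge bL); rewrite s0/= (le_trans (ltW st)).
  exact: (measurableT_comp mLs measurable_snd).
have phiE : phi = fun h => fine (\int[P]_w F^\+ (h, w) - \int[P]_w F^\- (h, w)).
  apply/funext => h; rewrite /phi; congr fine.
  rewrite integral_mkcond integralE; congr (_ - _); apply: eq_integral => w _.
    rewrite !funeposE /F /= patchE indicE.
    by case: ifPn => _; rewrite ?mul1r ?mul0r.
  rewrite !funenegE /F /= patchE indicE.
  by case: ifPn => _; rewrite ?mul1r ?mul0r.
rewrite phiE; apply: measurableT_comp; first exact: fine_measurable.
apply: emeasurable_funB.
  apply: (measurable_fun_fubini_tonelli_F (m2 := P) (F^\+)).
    exact: measurable_funepos.
  by move=> x; exact: funepos_ge0.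
apply: (measurable_fun_fubini_tonelli_F (m2 := P) (F^\-)).
  exact: measurable_funeneg.
by move=> x; exact: funeneg_ge0.
Qed.

Let phi_additive x y : (0 <= x)%R -> (0 <= y)%R -> (x + y <= t - s)%R ->
  phi (x + y)%R = (phi x + phi y)%R.
Proof.
move=> x0 y0 xyl; have s0' := s0; have st' := st; have tT' := tT.
rewrite /phi !clamp_id; [|lra..].
have -> : \int[P]_(w in E) (L (s + (x + y)) w - L s w)%:E =
    \int[P]_(w in E) (L (s + x) w - L s w)%:E +
    \int[P]_(w in E) (L (s + (x + y)) w - L (s + x) w)%:E.
  rewrite -integralD//; [|apply: integrable_on_E; lra..].
  by apply: eq_integral => w _; rewrite -EFinD; congr EFin; ring.
rewrite fineD; last 2 first.
- by apply: integrable_fin_num => //; apply: integrable_on_E; lra.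
- by apply: integrable_fin_num => //; apply: integrable_on_E; lra.
congr (_ + fine _)%R.
apply: (@integral_same_law _ _ _ _ _ _ RR P P E E (fun w => L (s + (x + y)) w - L (s + x) w)%R
  (fun w => L (s + y) w - L s w)%R EFin) => //.
- by apply: (measurable_bridge_increment bL); lra.
- by apply: (measurable_bridge_increment bL); lra.
move=> B mB.
have := @bridge_reflection _ _ _ _ _ _ _ bL s (s + (x + y))%R y A B s0.
rewrite (_ : s + (x + y) - y = s + x)%R; last lra.
move=> H; apply/esym/H => //; [lra|lra|].
apply: coordinate_sets_subset mA => r [rT [rs|tr]]; split => //; [by left|right].
by lra.
Qed.

(** The expectation [phi h] of the increment over [(s, s + h)] on an event seen
    outside [(s, t)] is additive in [h]: by reflection over [(s, s + x + y)], the
    increment over the last [y] units of time can be replaced by the one over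
    the first [y].  It is measurable by Tonelli's theorem, hence linear. *)
Lemma bridge_harness h : (0 <= h <= t - s)%R ->
  \int[P]_(w in E) (L (s + h) w - L s w)%:E =
  (h / (t - s))%:E * \int[P]_(w in E) (L t w - L s w)%:E.
Proof.
move=> ht; have s0' := s0; have st' := st; have tT' := tT.
have l0 : (0 < t - s)%R by lra.
have := additive_measurable_linear l0 measurable_phi phi_additive ht.
rewrite /phi !clamp_id; [|lra..].
rewrite (_ : s + (t - s) = t)%R; last lra.
move=> phi_linear; have := congr1 EFin phi_linear; rewrite EFinM !fineK//.
- by apply: integrable_fin_num => //; apply: integrable_on_E; lra.
- by apply: integrable_fin_num => //; apply: integrable_on_E; lra.
Qed.

End bridge_harness.

(** Allows the increment to be moved while it is added to other increments of the
    bridge. *)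
Lemma bridge_reflection_joint (s u h : R) (Y : (R -> R) -> RR)
    (g : RR * RR -> \bar R) :
  (0 <= s)%R -> (s <= u)%R -> (u <= T)%R -> (0 <= h <= u - s)%R ->
  measurable_fun setT (Y : g_sigma_algebraType (coordinate_sets (outside T s u)) -> RR) ->
  measurable_fun setT g ->
  \int[P]_w g (L (s + h) w - L s w, Y (L ^~ w))%R =
  \int[P]_w g (L u w - L (u - h) w, Y (L ^~ w))%R.
Proof.
move=> s0 su uT hsu mY mg.
have mYL : measurable_fun setT ((fun w => Y (L ^~ w)) : Omega -> RR).
  move=> _ B mB; rewrite setTI.
  apply: (@measurable_outside_event _ _ _ _ _ _ _ bL (outside T s u) (Y @^-1` B)).
    by move=> r [].
  by have := mY measurableT B mB; rewrite setTI.
have mD1 : measurable_fun setT ((fun w => L (s + h) w - L s w)%R : Omega -> RR).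
  by apply: (measurable_bridge_increment bL); lra.
have mD2 : measurable_fun setT ((fun w => L u w - L (u - h) w)%R : Omega -> RR).
  by apply: (measurable_bridge_increment bL); lra.
pose Z1 w : RR * RR := ((L (s + h) w - L s w)%R, Y (L ^~ w)).
pose Z2 w : RR * RR := ((L u w - L (u - h) w)%R, Y (L ^~ w)).
have mZ1 : measurable_fun setT Z1 by exact: measurable_fun_pair.
have mZ2 : measurable_fun setT Z2 by exact: measurable_fun_pair.
have law (Z : Omega -> RR * RR) : measurable_fun setT Z ->
    exists m : {measure set (RR * RR) -> \bar R}, forall B, m B = P (Z @^-1` B).
  move=> mZ; pose m := (pushforward P Z : {measure set (RR * RR) -> \bar R}).
  by exists (m mZ).
have [m1 m1E] := law _ mZ1; have [m2 m2E] := law _ mZ2.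
apply: (@integral_same_law _ _ _ _ _ _ (RR * RR)%type P P setT setT Z1 Z2 g) => //.
move=> B mB; rewrite !setTI.
suff m12 : m1 B = m2 B by have := m12; rewrite m1E m2E; exact.
pose G : set (set (RR * RR)) := [set C `*` D | C in measurable & D in measurable].
have mG : G `<=` measurable.
  by move=> _ [C mC [D mD <-]]; exact: measurableX.
apply: (g_sigma_algebra_measure_unique G mG (fun=> setT)).
- by move=> _; exists setT => //; exists setT => //; rewrite setXTT.
- by apply/seteqP; split => // p _; exists 0%N.
- move=> _ _ [C mC [D mD <-]] [C' mC' [D' mD' <-]].
  exists (C `&` C'); first exact: measurableI.
  by exists (D `&` D'); [exact: measurableI|rewrite setXI].
- move=> _ [C mC [D mD <-]]; rewrite m1E m2E.
  have mYD : <<s coordinate_sets (outside T s u) >> (Y @^-1` D).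
    by have := mY measurableT D mD; rewrite setTI.
  have := bridge_reflection bL s0 uT hsu mYD mC.
  rewrite setIC [in RHS]setIC => refl.
  exact: refl.
- move=> _; rewrite m1E; apply: (@le_lt_trans _ _ 1); last by rewrite ltry.
  by apply: probability_le1; rewrite preimage_setT.
- by rewrite -measurable_prod_measurableType.
Qed.

End bridge_consequences.

(** * Integrability of the increments of a bridge *)

Section partial_sum.
Context {R : realType} {n : nat} (m : 'rV[R]_n).
Hypothesis hm : forall i : 'I_n, (0 < m ord0 i)%R.

Definition partial_sum (k : nat) : R := (\sum_(j < n | (j < k)%N) m ord0 j)%R.

Lemma partial_sum0 : partial_sum 0 = 0%R.
Proof. by rewrite /partial_sum big_pred0. Qed.

Lemma partial_sum_full : partial_sum n = (\sum_(j < n) m ord0 j)%R.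
Proof. by apply: eq_bigl => j; rewrite ltn_ord. Qed.

Lemma partial_sumS (i : 'I_n) :
  partial_sum i.+1 = (partial_sum i + m ord0 i)%R.
Proof.
rewrite /partial_sum (bigD1 i)//= addrC; congr (_ + _)%R.
by apply: eq_bigl => j; rewrite ltnS ltn_neqAle andbC.
Qed.

Lemma le_partial_sum (k k' : nat) : (k <= k')%N ->
  (partial_sum k <= partial_sum k')%R.
Proof.
move=> kk'; rewrite /partial_sum [leRHS](bigID (fun j : 'I_n => (j < k)%N))/=.
rewrite [X in (_ <= X + _)%R](eq_bigl (fun j : 'I_n => (j < k)%N)); last first.
  by move=> j /=; apply: andb_idl => jk; exact: leq_trans jk kk'.
by rewrite lerDl; apply: sumr_ge0 => j _; exact/ltW/hm.
Qed.

Lemma partial_sum_ge0 k : (0 <= partial_sum k)%R.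
Proof. by rewrite -partial_sum0; exact: le_partial_sum. Qed.

Lemma partial_sum_le_full k : (k <= n)%N ->
  (partial_sum k <= \sum_(j < n) m ord0 j)%R.
Proof. by rewrite -partial_sum_full; exact: le_partial_sum. Qed.

End partial_sum.

Section moments.
Local Open Scope ereal_scope.
Context {R : realType} {n : nat} (m : 'rV[R]_n)
  {d} {Omega : measurableType d} (P : probability Omega R)
  (nu : probability (measurableTypeR R) R) (L : R -> Omega -> R).
Notation RR := (measurableTypeR R).
Hypothesis hm : forall i : 'I_n, (0 < m ord0 i)%R.
Local Notation T := (\sum_(j < n) m ord0 j)%R.
Local Notation U := (partial_sum m).
Hypothesis bL : levy_random_bridge P T nu L.

(** Interpolates between the sum of the increments over the beginnings, of
    length [t * m_i], of all the blocks (for [k = 0]) and the increment over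
    [(0, t * T)] (for [k = n]): the beginnings of the first [k] blocks have been
    moved next to each other. *)
Definition gathered (t : R) (k : nat) (p : R -> R) : R :=
  (p (t * U k) - p 0 +
   \sum_(i < n | (k <= i)%N) (p (t * m ord0 i + U i) - p (U i)))%R.

(** Moving one more beginning, from [(U k, U k + h)] to [(s, s + h)] with
    [s = t * U k], is a reflection over [(s, U k + h)]; all the other increments
    lie outside this interval. *)
Lemma gathered_step (t : R) (k : nat) : (0 <= t <= 1)%R -> (k < n)%N ->
  \int[P]_w (`|gathered t k (L ^~ w)|)%:E =
  \int[P]_w (`|gathered t k.+1 (L ^~ w)|)%:E.
Proof.
move=> t01 kn; pose i0 := Ordinal kn.
have [t0 t1] := andP t01; have mk := hm i0.
have US : U k.+1 = (U k + m ord0 i0)%R by exact: (partial_sumS m i0).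
have Uk0 := partial_sum_ge0 hm k.
have Uk1 := partial_sum_le_full hm kn.
pose s := (t * U k)%R; pose h := (t * m ord0 i0)%R; pose u := (h + U k)%R.
pose Y (p : R -> R) : RR := (p s - p 0 +
  \sum_(i < n | (k.+1 <= i)%N) (p (t * m ord0 i + U i) - p (U i)))%R.
have s0 : (0 <= s)%R by rewrite mulr_ge0.
have sU : (s <= U k)%R by rewrite ler_piMl.
have h0 : (0 <= h)%R by rewrite mulr_ge0// ltW.
have hm' : (h <= m ord0 i0)%R by rewrite ler_piMl// ltW.
have su : (s <= u)%R by rewrite /u; lra.
have uU : (u <= U k.+1)%R by rewrite /u; lra.
have uT : (u <= T)%R by lra.
have hsu : (0 <= h <= u - s)%R by rewrite /u; lra.
have mY : measurable_fun setT
    (Y : g_sigma_algebraType (coordinate_sets (outside T s u)) -> RR).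
  have mc r : outside T s u r -> measurable_fun setT
    ((fun p => p r) : g_sigma_algebraType (coordinate_sets (outside T s u)) -> RR).
    by move=> or _ B mB; rewrite setTI; apply: sub_sigma_algebra; exists r, B.
  apply: measurable_funD.
    apply: measurable_funB; apply: mc; (split; last by left; lra); lra.
  rewrite [X in measurable_fun _ X](_ : _ = (fun p : R -> R => \sum_(i < n)
      (if (k < i)%N then p (t * m ord0 i + U i) - p (U i) else 0))%R); last first.
    by apply/funext => p; rewrite big_mkcond.
  apply: measurable_sum => i.
  have [ki|_] := boolP (k < i)%N; last exact: measurable_cst.
  have mi := hm i; have Ui := le_partial_sum hm ki.
  have iT := partial_sum_le_full hm (ltn_ord i).
  have US' := partial_sumS m i.
  have tmi : (0 <= t * m ord0 i <= m ord0 i)%R.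
    by rewrite mulr_ge0 ?ler_piMl// ltW.
  apply: measurable_funB; apply: mc; (split; last by right; lra); lra.
have := @bridge_reflection_joint _ _ _ _ _ _ _ bL s u h Y
  (fun xy => (`|xy.1 + xy.2|)%:E) s0 su uT hsu mY.
have mg : measurable_fun setT (fun xy : RR * RR => (`|xy.1 + xy.2|)%:E).
  apply/measurable_EFinP; apply: measurableT_comp => //.
  by apply: measurable_funD; [exact: measurable_fst|exact: measurable_snd].
move=> /(_ mg) /= refl.
transitivity (\int[P]_w (`|L u w - L (u - h) w + Y (L^~ w)|)%:E); last first.
  rewrite -refl; apply: eq_integral => w _; congr (`|_|%:E)%R.
  rewrite /gathered /Y US mulrDr; rewrite /s /h; ring.
apply: eq_integral => w _; congr (`|_|%:E)%R.
rewrite /gathered (bigD1 i0)//= /Y (_ : u - h = U k)%R; last by rewrite /u; ring.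
rewrite (eq_bigl (fun i : 'I_n => (k < i)%N)); last first.
  by move=> i; rewrite ltn_neqAle andbC eq_sym.
by rewrite /u /h /s; ring.
Qed.

(** The hypothesis only bounds the sum of the coordinates; at time [t] this sum
    has the law of [L (t * T) - L 0]. *)
Lemma integrable_from_origin :
  (forall t : R, (0 <= t <= 1)%R ->
     \int[P]_w (`|\sum_(i < n) (L (t * m ord0 i + block_start m i) w -
                               L (block_start m i) w)|)%:E < +oo) ->
  forall r, (0 <= r <= T)%R ->
    P.-integrable setT (fun w => (L r w - L 0%R w)%:E).
Proof.
move=> hint r /andP[r0 rT]; have [T0 _ _] := bL.
pose t := (r / T)%R; have t01 : (0 <= t <= 1)%R.
  by rewrite /t divr_ge0 ?(ltW T0)//= ler_pdivrMr// mul1r.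
have tT : (t * T = r)%R by rewrite divfK// gt_eqF.
have gathered_all k : (k <= n)%N ->
    \int[P]_w (`|gathered t k (L ^~ w)|)%:E < +oo.
  elim: k => [_|k IH kn]; last by rewrite -gathered_step//; exact/IH/ltnW.
  rewrite (_ : \int[P]_w _ = \int[P]_w (`|\sum_(i < n)
    (L (t * m ord0 i + block_start m i) w - L (block_start m i) w)|)%:E).
    exact: hint.
  by apply: eq_integral => w _; rewrite /gathered partial_sum0 mulr0 subrr add0r.
apply/integrableP; split.
  apply/measurable_EFinP; apply: (measurable_bridge_increment bL).
    by rewrite r0.
  by rewrite lexx ltW.
have := gathered_all n (leqnn n); congr (_ < +oo); apply: eq_integral => w _.
rewrite /gathered partial_sum_full tT big_pred0 ?addr0// => i.
by rewrite leqNgt ltn_ord.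
Qed.

End moments.

(** * Block processes *)

Section sigma_process.
Context {R : realType} {n : nat}.
Notation RR := (measurableTypeR R).

Lemma preimage_generated (U V : Type) (h : U -> V) (G : set (set V))
    (H : set (set U)) :
  (forall A, G A -> <<s H >> (h @^-1` A)) ->
  forall A, <<s G >> A -> <<s H >> (h @^-1` A).
Proof.
move=> GH A; apply: (smallest_sub (X := [set B | <<s H >> (h @^-1` B)])) => //.
split.
- by rewrite /= preimage_set0; exact: sigma_algebra0.
- by move=> B /= HB; rewrite setTD preimage_setC -setTD; exact: sigma_algebraCD.
- by move=> F /= HF; rewrite preimage_bigcup; exact: sigma_algebra_bigcup.
Qed.

(** This brings any event of the process under the scope of [eq_in_law], which
    only speaks of events on path space. *)
Lemma sigma_process_path (S : Type) (J : set R) (H : R -> S -> 'rV[R]_n) (A : set S) :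
  sigma_process J H A ->
  exists2 B, sigma_process J (fun t (x : R -> 'rV[R]_n) => x t) B &
    A = [set w | B (H ^~ w)].
Proof.
pose K := [set A' | exists2 B,
  sigma_process J (fun t (x : R -> 'rV[R]_n) => x t) B &
    A' = [set w | B (H ^~ w)]].
apply: (smallest_sub (X := K)).
  split.
  - by exists set0 => //; exact: sigma_algebra0.
  - move=> _ [B sB ->]; exists (~` B); last by rewrite setTD.
    by rewrite -setTD; exact: sigma_algebraCD.
  - move=> F KF.
    have /choice[G GP] : forall k, exists B,
        sigma_process J (fun t (x : R -> 'rV[R]_n) => x t) B /\
        F k = [set w | B (H ^~ w)].
      by move=> k; have [B sB FE] := KF k; exists B.
    exists (\bigcup_k G k).
      by apply: sigma_algebra_bigcup => k; exact: (GP k).1.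
    apply/seteqP; split => w /=.
      by move=> [k _]; rewrite (GP k).2 => Gk; exists k.
    by move=> [k _ Gk]; exists k => //; rewrite (GP k).2.
move=> _ [t [i [B [Jt mB ->]]]].
exists [set x : R -> 'rV[R]_n | B (x t ord0 i)] => //.
by apply: sub_sigma_algebra; exists t, i, B.
Qed.

End sigma_process.

Section block_process.
Local Open Scope ereal_scope.
Context {R : realType} {n : nat} (m : 'rV[R]_n)
  {d} {Omega : measurableType d} (P : probability Omega R)
  (nu : probability (measurableTypeR R) R) (L : R -> Omega -> R).
Notation RR := (measurableTypeR R).
Hypothesis hm : forall i : 'I_n, (0 < m ord0 i)%R.
Local Notation T := (\sum_(j < n) m ord0 j)%R.
Local Notation U := (partial_sum m).
Hypothesis bL : levy_random_bridge P T nu L.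
Hypothesis intL : forall r, (0 <= r <= T)%R ->
    P.-integrable setT (fun w => (L r w - L 0%R w)%:E).

Definition block_path (p : R -> R) : R -> 'rV[R]_n := fun t =>
  \row_(i < n) (p (t * m ord0 i + block_start m i) - p (block_start m i))%R.

Lemma block_time_bounds (t : R) (i : 'I_n) : (0 <= t <= 1)%R ->
  (U i <= t * m ord0 i + U i <= U i.+1)%R.
Proof.
move=> /andP[t0 t1]; have mi := hm i; rewrite (partial_sumS m i).
by rewrite addrC lerDl mulr_ge0 ?(ltW mi)//= lerD2l ler_piMl// ltW.
Qed.

Lemma block_bounds (i : 'I_n) : [/\ 0 <= U i, U i <= T, 0 <= U i.+1 & U i.+1 <= T]%R.
Proof.
split; [exact: partial_sum_ge0|apply: partial_sum_le_full => //; exact/ltnW|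
  exact: partial_sum_ge0|exact: partial_sum_le_full].
Qed.

(** In every block other than [i], and in block [i] at times outside [(a, e)],
    the block process only looks at the bridge outside the [i]-th image of
    [(a, e)]. *)
Lemma block_path_outside (a e : R) (i : 'I_n) (A : set (R -> 'rV[R]_n)) :
  (0 <= a)%R -> (a < e)%R -> (e <= 1)%R ->
  sigma_process (`[0%R, 1%R] `&` [set t | (t <= a)%R \/ (e <= t)%R])
    (fun t (x : R -> 'rV[R]_n) => x t) A ->
  <<s coordinate_sets (outside T (a * m ord0 i + U i) (e * m ord0 i + U i)) >>
    (block_path @^-1` A).
Proof.
move=> a0 ae e1; apply: preimage_generated => _ [t [j [B [[+ tae] mB ->]]]].
rewrite /= in_itv/= => t01.
set J := outside _ _ _.
have ha : (0 <= a <= 1)%R by lra.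
have he : (0 <= e <= 1)%R by lra.
have [si1 si2] := andP (block_time_bounds i ha).
have [ui1 ui2] := andP (block_time_bounds i he).
have [tj1 tj2] := andP (block_time_bounds j t01).
have [Uj0 UjT Uj0' UjT'] := block_bounds j.
have mi := hm i.
have [J1 J2] : J (t * m ord0 j + U j)%R /\ J (U j).
  case: (ltngtP i j) => ij.
  - have := le_partial_sum hm ij; split; split; first [lra|right; lra].
  - have := le_partial_sum hm ij; split; split; first [lra|left; lra].
  - have {}ij : i = j by exact: val_inj.
    rewrite -ij in tj1 tj2 Uj0 UjT Uj0' UjT' *.
    split; split; [lra| |lra|left; lra].
    by case: tae => tae; [left|right]; rewrite lerD2r ler_pM2r.
have mc r : J r -> measurable_fun setT
  ((fun p => p r) : g_sigma_algebraType (coordinate_sets J) -> RR).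
  by move=> Jr _ C mC; rewrite setTI; apply: sub_sigma_algebra; exists r, C.
have mD : measurable_fun setT
  ((fun p => p (t * m ord0 j + U j) - p (U j))%R : g_sigma_algebraType (coordinate_sets J) -> RR).
  by apply: measurable_funB; exact: mc.
have := mD measurableT B mB; rewrite setTI; congr (<<s _ >> _).
by apply/seteqP; split => p /=; rewrite mxE.
Qed.

Lemma block_process_harness (a b c e : R) (i : 'I_n) (A : set (R -> 'rV[R]_n)) :
  (0 <= a)%R -> (a < b)%R -> (b < c)%R -> (c < e)%R -> (e <= 1)%R ->
  sigma_process (`[0%R, 1%R] `&` [set t | (t <= a)%R \/ (e <= t)%R])
    (fun t (x : R -> 'rV[R]_n) => x t) A ->
  \int[P]_(w in [set w | A (block_path (L ^~ w))])
    (block_path (L ^~ w) c ord0 i - block_path (L ^~ w) b ord0 i)%:E =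
  ((c - b) / (e - a))%:E *
  \int[P]_(w in [set w | A (block_path (L ^~ w))])
    (block_path (L ^~ w) e ord0 i - block_path (L ^~ w) a ord0 i)%:E.
Proof.
move=> a0 ab bc ce e1 sA.
have ae : (a < e)%R by lra.
have mA := block_path_outside (i := i) a0 ae e1 sA.
have ha : (0 <= a <= 1)%R by lra.
have he : (0 <= e <= 1)%R by lra.
have [si1 si2] := andP (block_time_bounds i ha).
have [ui1 ui2] := andP (block_time_bounds i he).
have [Ui0 UiT Ui0' UiT'] := block_bounds i.
have mi := hm i.
pose s := (a * m ord0 i + U i)%R; pose t := (e * m ord0 i + U i)%R.
have s0 : (0 <= s)%R by rewrite /s; lra.
have tT : (t <= T)%R by rewrite /t; lra.
have lE : (t - s = (e - a) * m ord0 i)%R by rewrite /s /t; ring.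
have st : (s < t)%R by rewrite -subr_gt0 lE mulr_gt0// subr_gt0.
set E := [set w | A (block_path (L ^~ w))].
have incE y z w : (block_path (L ^~ w) y ord0 i - block_path (L ^~ w) z ord0 i =
    L (y * m ord0 i + U i) w - L (z * m ord0 i + U i) w)%R.
  by rewrite !mxE /block_start -/(U i); ring.
under eq_integral do rewrite incE.
under [in RHS]eq_integral do rewrite incE.
have mN0 : m ord0 i != 0%R by rewrite gt_eqF.
have eaN0 : (e - a != 0)%R by rewrite subr_eq0 gt_eqF.
have harn x : (a <= x <= e)%R ->
    \int[P]_(w in E) (L (x * m ord0 i + U i) w - L s w)%:E =
    ((x - a) / (e - a))%:E * \int[P]_(w in E) (L t w - L s w)%:E.
  move=> /andP[ax xe].
  have hx : (0 <= (x - a) * m ord0 i <= t - s)%R.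
    rewrite lE mulr_ge0 ?(ltW mi) ?subr_ge0//=.
    by rewrite ler_pM2r// lerD2r.
  have := bridge_harness bL s0 st tT mA intL hx.
  rewrite (_ : s + (x - a) * m ord0 i = x * m ord0 i + U i)%R; last first.
    by rewrite /s; ring.
  move=> ->; congr (_%:E * _); rewrite lE; field.
  by rewrite ?mN0 ?eaN0.
have intE y z : (0 <= y <= T)%R -> (0 <= z <= T)%R ->
    P.-integrable E (fun w => (L y w - L z w)%:E).
  move=> hy hz; apply: integrableS (integrable_increment intL hy hz) => //.
  by apply: (measurable_outside_event bL _ mA) => r [].
have dom x : (a <= x <= e)%R -> (0 <= x * m ord0 i + U i <= T)%R.
  move=> hx; have hx1 : (0 <= x <= 1)%R by lra.
  by have [] := andP (block_time_bounds i hx1); lra.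
have dom_b : (0 <= b * m ord0 i + U i <= T)%R by apply: dom; lra.
have dom_c : (0 <= c * m ord0 i + U i <= T)%R by apply: dom; lra.
have dom_s : (0 <= s <= T)%R by lra.
have dom_t : (0 <= t <= T)%R by lra.
have mE : measurable E.
  by apply: (measurable_outside_event bL _ mA) => r [].
transitivity (\int[P]_(w in E) (L (c * m ord0 i + U i) w - L s w)%:E -
    \int[P]_(w in E) (L (b * m ord0 i + U i) w - L s w)%:E).
  rewrite -integralB//; [|exact: intE..].
  by apply: eq_integral => w _; rewrite -EFinB; congr EFin; ring.
have ha_c : (a <= c <= e)%R by lra.
have ha_b : (a <= b <= e)%R by lra.
rewrite (harn c ha_c) (harn b ha_b).
have /fineK <- : \int[P]_(w in E) (L t w - L s w)%:E \is a fin_num.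
  by apply: integrable_fin_num => //; exact: intE.
rewrite -!EFinM -EFinB; congr EFin; rewrite -mulrBl; congr (_ * _)%R; field.
by rewrite ?eaN0.
Qed.

End block_process.

(** * Liouville processes *)

Section process_events.
Local Open Scope ereal_scope.
Context {R : realType} {n : nat}.
Notation RR := (measurableTypeR R).

(** The generators of [sigma_process J H], named to regard the latter as the
    sigma-algebra of a measurable type. *)
Definition process_gen (S : Type) (J : set R) (H : R -> S -> 'rV[R]_n) : set (set S) :=
  [set A | exists t i (B : set RR), [/\ J t, measurable B & A = [set w | B (H t w ord0 i)]]].

Lemma measurable_process_coordinate (S : pointedType) (J : set R)
    (H : R -> S -> 'rV[R]_n) t i : J t ->
  measurable_fun setT ((fun w => H t w ord0 i) :
    g_sigma_algebraType (process_gen J H) -> RR).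
Proof.
move=> Jt _ B mB; rewrite setTI; apply: sub_sigma_algebra.
by exists t, i, B.
Qed.

Lemma measurable_process_event d (S : measurableType d) (J : set R)
    (H : R -> S -> 'rV[R]_n) (A : set (R -> 'rV[R]_n)) :
  (forall t i, J t -> measurable_fun setT ((fun w => H t w ord0 i) : S -> RR)) ->
  sigma_process J (fun t x => x t) A -> measurable [set w | A (H ^~ w)].
Proof.
move=> mH.
apply: (smallest_sub (X := [set B | measurable [set w | B (H ^~ w)]])).
  split.
  - exact: measurable0.
  - move=> B mB; rewrite /= (_ : [set w | _] = ~` [set w | B (H ^~ w)]).
      exact: measurableC.
    by apply/seteqP; split => w /=; [case|split].
  - move=> F mF /=.
    rewrite (_ : [set w | _] = \bigcup_k [set w | F k (H ^~ w)]); last first.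
      by apply/seteqP; split => w [k _ Fk]; exists k.
    by apply: bigcup_measurable => k _; exact: mF.
move=> _ [t [i [B [Jt mB ->]]]] /=.
by have := mH t i Jt measurableT B mB; rewrite setTI.
Qed.

Lemma sigma_process_measurable d (S : measurableType d) (J : set R)
    (H : R -> S -> 'rV[R]_n) (A : set S) :
  (forall t i, J t -> measurable_fun setT ((fun w => H t w ord0 i) : S -> RR)) ->
  sigma_process J H A -> measurable A.
Proof.
move=> mH /sigma_process_path[B sB ->].
exact: measurable_process_event sB.
Qed.

Lemma sigma_process_subset (S : Type) (J K : set R) (H : R -> S -> 'rV[R]_n) (A : set S) :
  J `<=` K -> sigma_process J H A -> sigma_process K H A.
Proof.
move=> JK; apply: sub_sigma_algebra2 => _ [t [i [B [Jt mB ->]]]].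
by exists t, i, B; split => //; exact: JK.
Qed.

Lemma eq_in_law_integral d d' (Omega : measurableType d) (Omega' : measurableType d')
    (P : probability Omega R) (P' : probability Omega' R) (J : set R)
    (X : R -> Omega -> 'rV[R]_n) (X' : R -> Omega' -> 'rV[R]_n)
    (A : set (R -> 'rV[R]_n)) (Y : (R -> 'rV[R]_n) -> RR) (g : RR -> \bar R) :
  (forall t i, J t -> measurable_fun setT ((fun w => X t w ord0 i) : Omega -> RR)) ->
  (forall t i, J t -> measurable_fun setT ((fun w => X' t w ord0 i) : Omega' -> RR)) ->
  eq_in_law P P' J X X' -> sigma_process J (fun t x => x t) A ->
  measurable_fun setT (Y : g_sigma_algebraType
    (process_gen J (fun t (x : R -> 'rV[R]_n) => x t)) -> RR) ->
  measurable_fun setT g ->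
  \int[P]_(w in [set w | A (X ^~ w)]) g (Y (X ^~ w)) =
  \int[P']_(w in [set w | A (X' ^~ w)]) g (Y (X' ^~ w)).
Proof.
move=> mX mX' PP' sA mY mg.
have YB B : measurable B -> sigma_process J (fun t (x : R -> 'rV[R]_n) => x t) (Y @^-1` B).
  by move=> mB; have := mY measurableT B mB; rewrite setTI.
apply: (@integral_same_law _ _ _ _ _ _ RR P P' _ _ (fun w => Y (X ^~ w))
  (fun w => Y (X' ^~ w)) g) => //.
- exact: measurable_process_event sA.
- exact: measurable_process_event sA.
- move=> _ B mB; rewrite setTI.
  exact: (measurable_process_event mX (YB B mB)).
- move=> _ B mB; rewrite setTI.
  exact: (measurable_process_event mX' (YB B mB)).
move=> B mB.
apply: (PP' (A `&` Y @^-1` B)).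
apply: (@measurableI _ (g_sigma_algebraType
  (process_gen J (fun t (x : R -> 'rV[R]_n) => x t)))) => //.
exact: YB.
Qed.

End process_events.

Section glp.
Local Open Scope ereal_scope.
Context {R : realType} {d : measure_display}
  {Omega : measurableType d} (P : probability Omega R)
  {n : nat} (m : 'rV[R]_n) (nu : probability (measurableTypeR R) R)
  (xi : R -> Omega -> 'rV[R]_n).
Notation RR := (measurableTypeR R).
Local Notation unit_itv := (`[0%R, 1%R]%classic : set R).
Hypothesis hm : forall i : 'I_n, (0 < m ord0 i)%R.
Hypothesis hxi : generalised_liouville_process P nu m xi.
Hypothesis hint : forall t : R, (0 <= t <= 1)%R ->
  \int[P]_w (`|\sum_(i < n) xi t w ord0 i|)%:E < +oo.

Lemma measurable_glp t i : unit_itv t ->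
  measurable_fun setT ((fun w => xi t w ord0 i) : Omega -> RR).
Proof. by case: hxi => cxi _; exact: (cxi i).1. Qed.

(** Integrability depends on the law only, so that of the sum passes from [xi] to
    the blocks of the bridge, and from there to the bridge itself. *)
Lemma glp_bridge : exists (d' : measure_display) (Omega' : measurableType d')
    (P' : probability Omega' R) (L : R -> Omega' -> R),
  [/\ levy_random_bridge P' (\sum_(j < n) m ord0 j)%R nu L,
    (forall t i, unit_itv t -> measurable_fun setT
      ((fun w => block_path m (L ^~ w) t ord0 i) : Omega' -> RR)),
    eq_in_law P P' unit_itv xi (fun t w => block_path m (L ^~ w) t) &
    forall r, (0 <= r <= \sum_(j < n) m ord0 j)%R ->
      P'.-integrable setT (fun w => (L r w - L 0%R w)%:E)].
Proof.
have [_ [d' [S' [P' [L [bL law]]]]]] := hxi.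
exists d', S', P', L.
have mb t i : unit_itv t -> measurable_fun setT
      ((fun w => block_path m (L ^~ w) t ord0 i) : S' -> RR).
  rewrite /= in_itv/= => t01; under eq_fun do rewrite mxE.
  have [ti1 ti2] := andP (block_time_bounds hm i t01).
  have [Ui0 UiT Ui0' UiT'] := block_bounds hm i.
  by apply: (measurable_bridge_increment bL); rewrite /block_start -/(partial_sum m i); lra.
split => //.
apply: (integrable_from_origin hm bL) => t t01.
apply: le_lt_trans (hint t01).
pose Y (x : R -> 'rV[R]_n) : RR := (\sum_(i < n) x t ord0 i)%R.
have t01' : unit_itv t by rewrite /= in_itv.
have mY : measurable_fun setT (Y : g_sigma_algebraType
    (process_gen unit_itv (fun t (x : R -> 'rV[R]_n) => x t)) -> RR).
  apply: measurable_sum => i.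
  exact: (measurable_process_coordinate (H := fun t (x : R -> 'rV[R]_n) => x t)).
have mabs : measurable_fun setT (fun x : RR => (`|x|)%:E).
  by apply/measurable_EFinP; exact: (@normr_measurable R setT).
have := eq_in_law_integral (A := setT) measurable_glp mb law _ mY mabs.
have sT : sigma_process unit_itv (fun t (x : R -> 'rV[R]_n) => x t) setT.
  exact: (@measurableT _ (g_sigma_algebraType
    (process_gen unit_itv (fun t (x : R -> 'rV[R]_n) => x t)))).
move=> /(_ sT) ->.
rewrite le_eqVlt; apply/orP; left; apply/eqP.
apply: eq_integral => w _; rewrite /Y; congr (`|_|%:E)%R.
by apply: eq_bigr => i _; rewrite mxE.
Qed.

Lemma integrable_glp t i : (0 <= t <= 1)%R ->
  P.-integrable setT (fun w => (xi t w ord0 i)%:E).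
Proof.
move=> t01; have t01' : unit_itv t by rewrite /= in_itv.
have [d' [S' [P' [L [bL mb law intL]]]]] := glp_bridge.
apply/integrableP; split; first by apply/measurable_EFinP; exact: measurable_glp.
pose Y (x : R -> 'rV[R]_n) : RR := x t ord0 i.
have mY : measurable_fun setT (Y : g_sigma_algebraType
    (process_gen unit_itv (fun t (x : R -> 'rV[R]_n) => x t)) -> RR).
  exact: (measurable_process_coordinate (H := fun t (x : R -> 'rV[R]_n) => x t)).
have mabs : measurable_fun setT (fun x : RR => `|x%:E|).
  by apply: measurableT_comp => //; exact: EFin_measurable.
have sT : sigma_process unit_itv (fun t (x : R -> 'rV[R]_n) => x t) setT.
  exact: (@measurableT _ (g_sigma_algebraType
    (process_gen unit_itv (fun t (x : R -> 'rV[R]_n) => x t)))).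
have := eq_in_law_integral (A := setT) measurable_glp mb law sT mY mabs.
rewrite /Y => ->.
have [ti1 ti2] := andP (block_time_bounds hm i t01).
have [Ui0 UiT Ui0' UiT'] := block_bounds hm i.
have : P'.-integrable setT (fun w =>
   (L (t * m ord0 i + partial_sum m i) w - L (partial_sum m i) w)%:E).
  by apply: (integrable_increment intL); lra.
move=> /integrableP[_]; congr (_ < +oo); apply: eq_integral => w _.
by rewrite mxE.
Qed.

Lemma glp_increment_harness (a b c e : R) (i : 'I_n) (A : set Omega) :
  (0 <= a)%R -> (a < b)%R -> (b < c)%R -> (c < e)%R -> (e <= 1)%R ->
  sigma_process (unit_itv `&` [set t | (t <= a)%R \/ (e <= t)%R]) xi A ->
  \int[P]_(w in A) ((xi c w ord0 i - xi b w ord0 i) / (c - b))%:E =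
  \int[P]_(w in A) ((xi e w ord0 i - xi a w ord0 i) / (e - a))%:E.
Proof.
move=> a0 ab bc ce e1 sA.
have mA : measurable A.
  by apply: sigma_process_measurable sA => t j [t01 _]; exact: measurable_glp.
have [d' [S' [P' [L [bL mb law intL]]]]] := glp_bridge.
have int_inc y z : (0 <= y <= 1)%R -> (0 <= z <= 1)%R ->
    P.-integrable A (fun w => (xi y w ord0 i - xi z w ord0 i)%:E).
  move=> hy hz; apply: (@integrableS _ _ _ P setT) => //.
  under eq_fun do rewrite EFinB.
  by apply: integrableB => //; exact: integrable_glp.
have scaled y z k : (0 <= y <= 1)%R -> (0 <= z <= 1)%R ->
    \int[P]_(w in A) ((xi y w ord0 i - xi z w ord0 i) / k)%:E =
    \int[P]_(w in A) (xi y w ord0 i - xi z w ord0 i)%:E * (k^-1)%:E.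
  move=> hy hz; under eq_integral do rewrite EFinM.
  by rewrite integralZr//; exact: int_inc.
rewrite !scaled; [|lra..].
have [A' sA' AE] := sigma_process_path sA.
have sA'' : sigma_process unit_itv (fun t (x : R -> 'rV[R]_n) => x t) A'.
  by apply: sigma_process_subset sA' => t [].
have transfer y z : (0 <= y <= 1)%R -> (0 <= z <= 1)%R ->
    \int[P]_(w in A) (xi y w ord0 i - xi z w ord0 i)%:E =
    \int[P']_(w in [set w | A' (block_path m (L ^~ w))])
      (block_path m (L ^~ w) y ord0 i - block_path m (L ^~ w) z ord0 i)%:E.
  move=> hy hz; rewrite AE.
  pose Y (x : R -> 'rV[R]_n) : RR := (x y ord0 i - x z ord0 i)%R.
  have mY : measurable_fun setT (Y : g_sigma_algebraType
      (process_gen unit_itv (fun t (x : R -> 'rV[R]_n) => x t)) -> RR).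
    by apply: measurable_funB;
      apply: (measurable_process_coordinate (H := fun t (x : R -> 'rV[R]_n) => x t));
      rewrite /= in_itv.
  have mid : measurable_fun setT (fun x : RR => x%:E).
    by apply/measurable_EFinP; exact: measurable_id.
  have := eq_in_law_integral measurable_glp mb law sA'' mY mid.
  by rewrite /Y.
have fin_ea : \int[P]_(w in A) (xi e w ord0 i - xi a w ord0 i)%:E \is a fin_num.
  by apply: integrable_fin_num => //; apply: int_inc; lra.
have harn := block_process_harness hm bL intL i a0 ab bc ce e1 sA'.
move: harn; rewrite -!transfer; [|lra..] => ->.
rewrite -(fineK fin_ea) -!EFinM; congr EFin; field.
by rewrite !subr_eq0 !gt_eqF//; lra.
Qed.

End glp.

Section euclid_norm.
Context {R : realType} {n : nat}.
Notation RR := (measurableTypeR R).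

Lemma euclid_norm_le (x : 'rV[R]_n) :
  (euclid_norm x <= \sum_(i < n) `|x ord0 i|)%R.
Proof.
have s0 : (0 <= \sum_(i < n) `|x ord0 i|)%R by exact: sumr_ge0.
rewrite -[leRHS](ger0_norm s0) -sqrtr_sqr ler_wsqrtr// expr2 mulr_suml.
apply: ler_sum => i _; rewrite -real_normK ?num_real// expr2 ler_wpM2l//.
by rewrite (bigD1 i)//= lerDl sumr_ge0.
Qed.

Lemma measurable_euclid_norm d (S : measurableType d) (X : S -> 'rV[R]_n) :
  (forall i, measurable_fun setT ((fun w => X w ord0 i) : S -> RR)) ->
  measurable_fun setT ((fun w => euclid_norm (X w)) : S -> RR).
Proof.
move=> mX.
have msqrt : measurable_fun setT (Num.sqrt : RR -> RR).
  by apply: continuous_measurable_fun; exact: sqrt_continuous.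
apply: (measurableT_comp msqrt); apply: measurable_sum => i.
exact: (measurable_funX 2 (mX i)).
Qed.

End euclid_norm.

Section harness.
Local Open Scope ereal_scope.
Context {R : realType} {d : measure_display}
  {Omega : measurableType d} (P : probability Omega R)
  {n : nat} (m : 'rV[R]_n) (nu : probability (measurableTypeR R) R)
  (xi : R -> Omega -> 'rV[R]_n).
Notation RR := (measurableTypeR R).
Local Notation unit_itv := (`[0%R, 1%R]%classic : set R).
Hypothesis hm : forall i : 'I_n, (0 < m ord0 i)%R.
Hypothesis hxi : generalised_liouville_process P nu m xi.
Hypothesis hint : forall t : R, (0 <= t <= 1)%R ->
  \int[P]_w (`|\sum_(i < n) xi t w ord0 i|)%:E < +oo.

Lemma jointly_measurable_glp i :
  measurable_fun ((unit_itv : set RR) `*` [set: Omega])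
    (fun p : RR * Omega => xi p.1 p.2 ord0 i).
Proof.
have [cxi _] := hxi.
have mclamp := measurable_cadlag_process (@ltr01 R) (cxi i).
apply: (@eq_measurable_fun _ _ _ _ _
  (fun p : RR * Omega => xi (clamp 1 p.1) p.2 ord0 i)).
  move=> [t w]; rewrite inE /= => -[+ _]; rewrite in_itv/= => t01.
  by rewrite clamp_id.
exact: measurable_funTS.
Qed.

Lemma glp_harness : harness P xi.
Proof.
have mxi := measurable_glp hxi; have ixi := integrable_glp hm hxi hint.
split.
- exact: jointly_measurable_glp.
- move=> t t01; rewrite unlock.
  have t01' : unit_itv t by rewrite /= in_itv.
  apply: (@le_lt_trans _ _ (\int[P]_w (\sum_(i < n) `|xi t w ord0 i|%:E))).
    apply: ge0_le_integral => //.
    + by move=> w _; rewrite lee_fin sqrtr_ge0.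
    + by apply/measurable_EFinP; apply: measurable_euclid_norm => i; exact: mxi.
    + apply: emeasurable_sum => i; apply/measurable_EFinP.
      by apply: (measurableT_comp (@normr_measurable R setT)); exact: mxi.
    + by move=> w _; rewrite sumEFin lee_fin euclid_norm_le.
  rewrite ge0_integral_sum//; last first.
    move=> i; apply/measurable_EFinP.
    by apply: (measurableT_comp (@normr_measurable R setT)); exact: mxi.
  apply: lte_sum_pinfty => i _.
  by have /integrableP[_] := ixi t i t01.
- move=> a b c e a0 ab bc ce e1 i.
  set J := _ `&` _.
  have Ja : J a by split; [rewrite /= in_itv/=; lra|left].
  have Je : J e by split; [rewrite /= in_itv/=; lra|right].
  split.
  + apply: (@eq_integrable _ _ _ P setT measurableT (fun w => ((e - a)^-1)%:E *
        (xi e w ord0 i - xi a w ord0 i)%:E)).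
      by move=> w _; rewrite -EFinM /= mulrC.
    apply: integrableZl => //; under eq_fun do rewrite EFinB.
    by apply: integrableB => //; apply: ixi; lra.
  + move=> B mB.
    have mY : measurable_fun setT ((fun w =>
       ((xi e w ord0 i - xi a w ord0 i) / (e - a))%R) :
       g_sigma_algebraType (process_gen J xi) -> RR).
      apply: measurable_funM => //.
      by apply: measurable_funB; exact: measurable_process_coordinate.
    by have := mY measurableT B mB; rewrite setTI.
  + by move=> A sA; exact: (glp_increment_harness hm hxi hint).
Qed.

(** The past and future of the sum are events of the process itself; this is all
    that relates the two conditional expectations. *)
Lemma sigma_process_sum (J : set R) (A : set Omega) :
  sigma_process J (fun t w => \row_(i < 1) (\sum_(j < n) xi t w ord0 j)%R) A ->
  sigma_process J xi A.
Proof.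
apply: (smallest_sub (X := sigma_process J xi)).
  exact: smallest_sigma_algebra.
move=> _ [t [i [B [Jt mB ->]]]].
have mY : measurable_fun setT ((fun w => \sum_(j < n) xi t w ord0 j)%R :
    g_sigma_algebraType (process_gen J xi) -> RR).
  by apply: measurable_sum => j; exact: measurable_process_coordinate.
have := mY measurableT B mB; rewrite setTI; congr (sigma_process J xi _).
by apply/seteqP; split => w /=; rewrite mxE.
Qed.

Lemma glp_sum_harness : real_harness P (fun t w => (\sum_(i < n) xi t w ord0 i)%R).
Proof.
have mxi := measurable_glp hxi; have ixi := integrable_glp hm hxi hint.
have [_ _ hxi'] := glp_harness.
split.
- move=> i; apply: (@eq_measurable_fun _ _ _ _ _
    (fun p : RR * Omega => \sum_(j < n) xi p.1 p.2 ord0 j)%R).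
    by move=> p _; rewrite mxE.
  by apply: measurable_sum => j; exact: jointly_measurable_glp.
- move=> t t01; rewrite unlock.
  apply: le_lt_trans (hint t01); rewrite le_eqVlt; apply/orP; left; apply/eqP.
  apply: eq_integral => w _; congr EFin.
  by rewrite /euclid_norm big_ord1 mxE sqrtr_sqr.
- move=> a b c e a0 ab bc ce e1 i.
  set J := _ `&` _.
  have ea (w : Omega) (y z k : R) :
      (((\row_(i < 1) (\sum_(j < n) xi y w ord0 j)) ord0 i -
        (\row_(i < 1) (\sum_(j < n) xi z w ord0 j)) ord0 i) / k)%:E =
      \sum_(j < n) ((xi y w ord0 j - xi z w ord0 j) / k)%:E.
    by rewrite sumEFin !mxE -sumrB mulr_suml.
  have int_scaled y z k j : (0 <= y <= 1)%R -> (0 <= z <= 1)%R ->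
      P.-integrable setT (fun w => ((xi y w ord0 j - xi z w ord0 j) / k)%:E).
    move=> hy hz.
    apply: (@eq_integrable _ _ _ P setT measurableT (fun w => (k^-1)%:E *
        (xi y w ord0 j - xi z w ord0 j)%:E)).
      by move=> w _; rewrite -EFinM /= mulrC.
    apply: integrableZl => //; under eq_fun do rewrite EFinB.
    by apply: integrableB => //; exact: ixi.
  split.
  + rewrite (_ : _ \o _ = fun w => \sum_(j < n) ((xi e w ord0 j - xi a w ord0 j) / (e - a))%:E).
      by apply: integrable_sum => // j _; apply: int_scaled; lra.
    by apply/funext => w; rewrite /= ea.
  + have Ja : J a by split; [rewrite /= in_itv/=; lra|left].
    have Je : J e by split; [rewrite /= in_itv/=; lra|right].
    move=> B mB.
    pose H := (fun t (w : Omega) => \row_(i < 1) (\sum_(j < n) xi t w ord0 j)%R).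
    have mY : measurable_fun setT ((fun w =>
       ((H e w ord0 i - H a w ord0 i) / (e - a))%R) :
       g_sigma_algebraType (process_gen J H) -> RR).
      apply: measurable_funM => //.
      by apply: measurable_funB; exact: measurable_process_coordinate.
    by have := mY measurableT B mB; rewrite setTI.
  + move=> A sA.
    have {}sA := sigma_process_sum sA.
    have mA : measurable A.
      by apply: sigma_process_measurable sA => t j [t01 _]; exact: mxi.
    have sumE y z k : (0 <= y <= 1)%R -> (0 <= z <= 1)%R ->
       \int[P]_(w in A) (\sum_(j < n) ((xi y w ord0 j - xi z w ord0 j) / k)%:E) =
       \sum_(j < n) \int[P]_(w in A) ((xi y w ord0 j - xi z w ord0 j) / k)%:E.
      move=> hy hz; rewrite integral_sum// => j.
      by apply: integrableS (int_scaled _ _ _ _ hy hz).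
    under eq_integral do rewrite ea.
    under [in RHS]eq_integral do rewrite ea.
    rewrite !sumE; [|lra..].
    by apply: eq_bigr => j _; exact: (glp_increment_harness hm hxi hint).
Qed.

End harness.

Theorem proposition3p15 (R : realType) (d : measure_display)
  (Omega : measurableType d) (P : probability Omega R)
  (n : nat) (hn : (2 <= n)%N)
  (m : 'rV[R]_n) (hm : forall i : 'I_n, 0 < m ord0 i)
  (nu : probability (measurableTypeR R) R)
  (hnu : no_continuous_singular_part nu)
  (xi : R -> Omega -> 'rV[R]_n)
  (hxi : generalised_liouville_process P nu m xi)
  (hint : forall t : R, 0 <= t <= 1 ->
     ('E_P[fun w => (`|\sum_(i < n) xi t w ord0 i|)%R] < +oo)%E) :
  harness P xi /\ real_harness P (fun t w => \sum_(i < n) xi t w ord0 i).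
Proof.
have hint' (t : R) : 0 <= t <= 1 ->
    (\int[P]_w (`|\sum_(i < n) xi t w ord0 i|)%R%:E < +oo)%E.
  by move=> /hint; rewrite unlock.
split; first exact: glp_harness hm hxi hint'.
exact: glp_sum_harness hm hxi hint'.
Qed.
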